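(* Let $(\mathcal A,\varphi,\psi,B)$ be an operator-valued conditional probability space and let $a,b\in\mathcal A$ be conditionally free with $\varphi(a)=\varphi(b)=1=\psi(a)=\psi(b)$. For $x\in\{a,b,ab\}$ let $H_x,H_x^c\in\mathbb C_0[[\mathrm{End}\,B]]$ be the conditional $H$-transform of $x$. Let $H_{a\vdash b}\in\mathbb C_0[[\mathrm{End}\,B]]$ be the unique series with $$H_{a\vdash b}=(T_a\circ E)\circ(H_b\cdot I)\circ(I\cdot H_{a\vdash b}),$$ and set $H_{a\dashv b}:=H_b\circ(I\cdot H_{a\vdash b})$. Then $$H^c_{ab}=\big(H^c_a\circ(H_{a\dashv b}\cdot I)\big)\cdot\big(H^c_b\circ(I\cdot H_{a\vdash b})\big),$$ and, moreover, $$H_{a\dashv b}=H_b\circ\Big(I\cdot\big(H_a\circ(H_{a\dashv b}\cdot I)\big)\Big),\qquad H_{a\vdash b}=H_a\circ\Big(\big(H_b\circ(I\cdot H_{a\vdash b})\big)\cdot I\Big).$$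
   Context: Operator-valued conditional probability space $(\mathcal A,\varphi,\psi,B)$: a unital complex algebra $\mathcal A$ containing the unital algebra $B$ as a unital subalgebra, and two unital $B$-bimodule maps $\varphi,\psi\colon\mathcal A\to B$. For $a\in\mathcal A$, $\langle a\rangle$ is the subalgebra generated by $B$ and $a$. Elements $a_1,a_2$ are conditionally free if, whenever $p_j\in\langle a_{i_j}\rangle$, $\psi(p_j)=0$, $i_j\ne i_{j+1}$, one has $\psi(p_1\cdots p_n)=0$ and $\varphi(p_1\cdots p_n)=\varphi(p_1)\cdots\varphi(p_n)$. Multilinear series: $\mathbb C_0[[\mathrm{End}\,B]]$ is the set of $F=1+\sum_{n\ge1}F^{(n)}$ with $F^{(n)}\colon B^{\otimes n}\to B$ linear (degree-zero part $F^{(0)}=1\in B$), a group for the Cauchy product $(F\cdot G)^{(n)}(b_1,\dots,b_n)=\sum_{k=0}^nF^{(k)}(b_1,\dots,b_k)G^{(n-k)}(b_{k+1},\dots,b_n)$. The same product is used for series with arbitrary degree-zero part. $I$ is the series whose only nonzero component is $I^{(1)}=\mathrm{id}_B$. For a series $\alpha$ with $\alpha^{(0)}=0$, $(F\circ\alpha)^{(0)}=F^{(0)}$ and $(F\circ\alpha)^{(n)}=\sum_{k\ge1,\,q_1+\dots+q_k=n,\,q_i\ge1}F^{(k)}\circ(\alpha^{(q_1)}\otimes\cdots\otimes\alpha^{(q_k)})$. Cumulants of $x$ with $\varphi(x)=\psi(x)=1$: let $C^\varphi_x,C^\psi_x$ be the series with zero degree-zero part whose degree-$(n+1)$ component is $(b_0,\dots,b_n)\mapsto\varphi(b_0xb_1x\cdots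 xb_n)$, resp. $\psi(b_0xb_1x\cdots xb_n)$, $n\ge0$. Then $K_x,K^c_x\in\mathbb C_0[[\mathrm{End}\,B]]$ are the unique series with $C^\psi_x=I+I\cdot(K_x\circ C_x^\psi)\cdot C_x^\psi$ and $C^\varphi_x=I+I\cdot(K_x^c\circ C_x^\psi)\cdot C_x^\varphi$. Transforms: $T_x,T_x^c\in\mathbb C_0[[\mathrm{End}\,B]]$ are the unique series with $K_x=T_x\circ(I\cdot K_x)$, $K_x^c=T_x^c\circ(I\cdot K_x)$. Put $E=\sum_{n\ge1}I^n$ (Cauchy powers, $E=\frac I{1-I}$). The conditional $H$-transform $(H_x,H_x^c)$ is given by the unique $H_x\in\mathbb C_0[[\mathrm{End}\,B]]$ with $H_x=(T_x\circ E)\circ(I\cdot H_x)$, and $H_x^c=(T_x^c\circ E)\circ(I\cdot H_x)$. *)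

(* Defs.v *)
From HB Require Import structures.
From mathcomp Require Import all_boot all_order all_algebra.
From mathcomp Require Import boolp classical_sets reals.
From mathcomp Require Export complex.

Set Implicit Arguments.
Unset Strict Implicit.
Unset Printing Implicit Defensive.

Import GRing.Theory.

Local Open Scope ring_scope.

(* A family of maps F^(n) : B^n -> B, n >= 0, is encoded as one function on   *)
(* finite sequences, F^(n) being its restriction to the sequences of size n.  *)
(* The linear maps B^{(x) n} -> B are the n-multilinear maps B^n -> B.        *)
Definition multilinear (K : fieldType) (B : algType K) (F : seq B -> B) : Prop :=
  forall (s t : seq B) (c : K) (x y : B),
    F (s ++ (c *: x + y) :: t) = c *: F (s ++ x :: t) + F (s ++ y :: t).

Record mseries (K : fieldType) (B : algType K) : Type := MSeries {
  ms_fun :> seq B -> B;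
  ms_multilinear : multilinear ms_fun
}.

Definition is_composition (n k : nat) (q : k.-tuple 'I_n.+1) : bool :=
  all (fun i : 'I_n.+1 => 0 < i)%N q && (sumn [seq val i | i <- q] == n).

Section Series.
Variables (K : fieldType) (B : algType K).
Implicit Types (F G H : mseries B) (s t : seq B).

Lemma msP F G : (forall s, F s = G s) -> F = G.
Proof.
case: F G => [f fP] [g gP] /= /funext fg.
by case: _ / fg gP => gP; rewrite (Prop_irrelevance fP gP).
Qed.

HB.instance Definition _ := gen_eqMixin (mseries B).
HB.instance Definition _ := gen_choiceMixin (mseries B).

Lemma zero_multilinear : @multilinear K B (fun=> 0).
Proof. by move=> *; rewrite scaler0 addr0. Qed.

Lemma opp_multilinear F : multilinear (fun s => - F s).
Proof. by move=> s t c x y; rewrite ms_multilinear opprD scalerN. Qed.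

Lemma add_multilinear F G : multilinear (fun s => F s + G s).
Proof. by move=> s t c x y; rewrite !ms_multilinear scalerDr addrACA. Qed.

Definition ms_zero := MSeries zero_multilinear.
Definition ms_opp F := MSeries (opp_multilinear F).
Definition ms_add F G := MSeries (add_multilinear F G).

Fact ms_addA : associative ms_add.
Proof. by move=> F G H; apply: msP => s /=; rewrite addrA. Qed.
Fact ms_addC : commutative ms_add.
Proof. by move=> F G; apply: msP => s /=; rewrite addrC. Qed.
Fact ms_add0 : left_id ms_zero ms_add.
Proof. by move=> F; apply: msP => s /=; rewrite add0r. Qed.
Fact ms_addN : left_inverse ms_zero ms_opp ms_add.
Proof. by move=> F; apply: msP => s /=; rewrite addNr. Qed.

HB.instance Definition _ :=
  GRing.isZmodule.Build (mseries B) ms_addA ms_addC ms_add0 ms_addN.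

Definition cauchy (F G : seq B -> B) (s : seq B) : B :=
  \sum_(k < (size s).+1) F (take k s) * G (drop k s).

Lemma cauchy_nil (F G : seq B -> B) : cauchy F G [::] = F [::] * G [::].
Proof. by rewrite /cauchy big_ord1. Qed.

Lemma cauchy_cons (F G : seq B -> B) x s :
  cauchy F G (x :: s) =
  F [::] * G (x :: s) + cauchy (fun t => F (x :: t)) G s.
Proof. by rewrite /cauchy big_ord_recl. Qed.

Lemma cauchy_multilinear F G : multilinear (cauchy F G).
Proof.
move=> s t c x y; rewrite /cauchy !size_cat /= scaler_sumr -big_split.
apply: eq_bigr => k _ /=; rewrite !take_cat !drop_cat; case: ltnP => ks.
  by rewrite ms_multilinear mulrDr scalerAr.
case: (k - size s)%N => [|j] /=; last by rewrite ms_multilinear mulrDl scalerAl.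
by rewrite (ms_multilinear G [::]) mulrDr scalerAr.
Qed.

Lemma one_multilinear : @multilinear K B (fun s => if s is [::] then 1 else 0).
Proof. by case=> [|a s] t c x y /=; rewrite scaler0 addr0. Qed.

Definition ms_one := MSeries one_multilinear.
Definition ms_mul F G := MSeries (cauchy_multilinear F G).

Lemma eq_cauchy (F F' G G' : seq B -> B) s :
  F =1 F' -> G =1 G' -> cauchy F G s = cauchy F' G' s.
Proof. by move=> eF eG; apply: eq_bigr => k _; rewrite eF eG. Qed.

Lemma cauchyDl (F F' G : seq B -> B) s :
  cauchy (fun t => F t + F' t) G s = cauchy F G s + cauchy F' G s.
Proof. by rewrite -big_split; apply: eq_bigr => k _; rewrite mulrDl. Qed.

Lemma cauchyDr (F G G' : seq B -> B) s :
  cauchy F (fun t => G t + G' t) s = cauchy F G s + cauchy F G' s.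
Proof. by rewrite -big_split; apply: eq_bigr => k _; rewrite mulrDr. Qed.

Lemma cauchyMl b (F G : seq B -> B) s :
  cauchy (fun t => b * F t) G s = b * cauchy F G s.
Proof. by rewrite /cauchy mulr_sumr; apply: eq_bigr => k _; rewrite mulrA. Qed.

Lemma cauchyA (F G H : seq B -> B) s :
  cauchy F (cauchy G H) s = cauchy (cauchy F G) H s.
Proof.
elim: s F => [|x s IHs] F; first by rewrite !cauchy_nil mulrA.
rewrite !cauchy_cons cauchy_nil IHs mulrDr mulrA -addrA; congr (_ + _).
under [RHS]eq_cauchy => [t|t] do [rewrite cauchy_cons|over].
by rewrite cauchyDl cauchyMl.
Qed.

Fact ms_mulA : associative ms_mul.
Proof. by move=> F G H; apply: msP => s /=; apply: cauchyA. Qed.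
Fact ms_mul1l : left_id ms_one ms_mul.
Proof.
move=> F; apply: msP => s /=; rewrite /cauchy big_ord_recl take0 drop0 mul1r.
rewrite big1 ?addr0 // => i _ /=.
by case: s i => [|x s] i /=; [case: i | rewrite mul0r].
Qed.
Fact ms_mul1r : right_id ms_one ms_mul.
Proof.
move=> F; apply: msP => s /=.
rewrite /cauchy big_ord_recr /= take_size drop_size mulr1.
rewrite big1 ?add0r // => i _ /=.
case E: (drop i s) => [|x t]; last by rewrite mulr0.
by have := size_drop i s; rewrite E => /esym/eqP; rewrite subn_eq0 leqNgt ltn_ord.
Qed.
Fact ms_mulDl : left_distributive ms_mul +%R.
Proof. by move=> F G H; apply: msP => s /=; apply: cauchyDl. Qed.
Fact ms_mulDr : right_distributive ms_mul +%R.
Proof. by move=> F G H; apply: msP => s /=; apply: cauchyDr. Qed.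

HB.instance Definition _ := GRing.Zmodule_isPzRing.Build (mseries B)
  ms_mulA ms_mul1l ms_mul1r ms_mulDl ms_mulDr.

Lemma msD F G s : (F + G) s = F s + G s. Proof. by []. Qed.
Lemma msB F G s : (F - G) s = F s - G s. Proof. by []. Qed.
Lemma msM F G s : (F * G) s = cauchy F G s. Proof. by []. Qed.

Fact I_multilinear :
  @multilinear K B (fun s => if s is [:: b] then b else 0).
Proof.
case=> [|a [|b s]] [|d t] c x y //=; rewrite ?scaler0 ?addr0 //.
Qed.

Definition ms_I : mseries B := MSeries I_multilinear.

(* 'E' is the sum of the I ^+ n, n >= 1; as I ^+ n vanishes in degrees other  *)
(* than n, only the terms n <= size s contribute at s.                        *)
Fact E_multilinear : @multilinear K B
  (fun s => \sum_(1 <= n < (size s).+1) (ms_I ^+ n) s).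
Proof.
move=> s t c x y; rewrite !size_cat /= scaler_sumr -big_split.
by apply: eq_bigr => n _; rewrite ms_multilinear.
Qed.

Definition ms_E : mseries B := MSeries E_multilinear.

(* (F o al)(b_1, .., b_n) is the sum, over k and the compositions q of n with *)
(* k parts, of F^(k) at the values of al on the consecutive blocks of sizes   *)
(* q_1, .., q_k; k = 0 contributes only for n = 0, with the value F^(0). The  *)
(* degree zero part of al is not used.                                        *)
Definition comp (F al : seq B -> B) (s : seq B) : B :=
  \sum_(k < (size s).+1) \sum_(q : k.-tuple 'I_(size s).+1 | is_composition q)
    F [seq al u | u <- reshape [seq val i | i <- q] s].

Lemma reshape_slot (sh : seq nat) s t :
  sumn sh = (size s + (size t).+1)%N ->
  exists p1 u v p2, forall x : B,
    reshape sh (s ++ x :: t) = p1 ++ (u ++ x :: v) :: p2.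
Proof.
elim: sh s => [|n sh IHsh] s /=; first by rewrite addnS.
have [sn e|ns e] := ltnP (size s) n.
  exists [::], s, (take (n - size s).-1 t),
    (reshape sh (drop (n - size s).-1 t)).
  move=> x; rewrite take_cat drop_cat ltnNge ltnW //=.
  by case: (n - size s)%N (subn_gt0 (size s) n) => [|j] //=; rewrite sn.
have [|p1 [u [v [p2 IH]]]] := IHsh (drop n s).
  by rewrite size_drop addnBAC // -e addKn.
exists (take n s :: p1), u, v, p2 => x.
rewrite take_cat drop_cat; move: ns; rewrite leq_eqVlt => /orP[/eqP ns|ns].
  by move: IH; rewrite ns ltnn subnn /= drop_size take_size cats0 => ->.
by rewrite ns IH.
Qed.

Lemma comp_multilinear F G : multilinear (comp F G).
Proof.
move=> s t c x y; rewrite /comp !size_cat /= scaler_sumr -big_split.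
apply: eq_bigr => k _; rewrite /= scaler_sumr -big_split.
apply: eq_bigr => q /andP[_ /eqP qs] /=.
have [p1 [u [v [p2 E]]]] := reshape_slot qs.
by rewrite !E !map_cat /= ms_multilinear ms_multilinear.
Qed.

Definition ms_comp F G : mseries B := MSeries (comp_multilinear F G).

Definition C0 : set (mseries B) := [set F | F [::] = 1].

(* The series satisfying P. It is applied below only to properties shown to   *)
(* have exactly one solution: see K_seriesP, Kc_seriesP, T_seriesP,           *)
(* Tc_seriesP, H_seriesP and H_vdashP.                                        *)
Definition the_series (P : set (mseries B)) : mseries B := xget 0 P.

Lemma the_seriesP (P : set (mseries B)) :
  (exists! F, P F) -> P (the_series P).
Proof. by move=> [F [PF _]]; apply: (xgetI 0 PF). Qed.

Lemma ms_IMnil F : (ms_I * F) [::] = 0.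
Proof. by rewrite msM cauchy_nil mul0r. Qed.

Lemma ms_IMcons F x s : (ms_I * F) (x :: s) = x * F s.
Proof.
rewrite msM cauchy_cons mul0r add0r /cauchy big_ord_recl take0 drop0.
by rewrite big1 ?addr0 // => i _; case: s i => [[]|y s i] //=; rewrite mul0r.
Qed.

Lemma ms_MInil F : (F * ms_I) [::] = 0.
Proof. by rewrite msM cauchy_nil mulr0. Qed.

Lemma ms_MIrcons F s x : (F * ms_I) (rcons s x) = F s * x.
Proof.
rewrite msM /cauchy size_rcons big_ord_recr big_ord_recr /=.
rewrite -cats1 drop_size_cat // take_size_cat //.
rewrite drop_oversize ?size_cat ?addn1 // mulr0 addr0.
rewrite big1 ?add0r // => i _; rewrite take_cat drop_cat ltn_ord.
have := size_drop i s; case: (drop i s) => [/esym/eqP|y [|z t] _] /=.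
- by rewrite subn_eq0 leqNgt ltn_ord.
- by rewrite mulr0.
- by rewrite mulr0.
Qed.

Lemma ms_mulIr : injective (fun F => F * ms_I).
Proof.
move=> F G FG; apply: msP => s.
by rewrite -[F s]mulr1 -[G s]mulr1 -!ms_MIrcons FG.
Qed.

Lemma ms_mulIl : injective (fun F => ms_I * F).
Proof.
move=> F G FG; apply: msP => s.
by rewrite -[F s]mul1r -[G s]mul1r -!ms_IMcons FG.
Qed.

Lemma comp_nil F al : ms_comp F al [::] = F [::].
Proof.
rewrite /= /comp big_ord1 (big_pred1 [tuple]) // => q.
by have -> : q = [tuple] by [apply: tuple0]; apply/esym/eqP.
Qed.

Lemma size_reshape_block (sh : seq nat) s u :
  u \in reshape sh s -> (size u <= size s)%N.
Proof.
elim: sh s => //= n sh IHsh s; rewrite inE => /orP[/eqP->|/IHsh].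
  by rewrite size_take_min geq_minr.
by move/leq_trans; apply; rewrite size_drop leq_subr.
Qed.

Lemma eq_compr F (al al' : seq B -> B) s :
  (forall u, (size u <= size s)%N -> al u = al' u) ->
  comp F al s = comp F al' s.
Proof.
move=> eal; apply: eq_bigr => k _; apply: eq_bigr => q _; congr (ms_fun F _).
by apply/eq_in_map => u /size_reshape_block /eal.
Qed.

Lemma all1_sumn (sh : seq nat) :
  all (leq 1) sh -> sumn sh = size sh -> sh = nseq (size sh) 1%N.
Proof.
have le (r : seq nat) : all (leq 1) r -> (size r <= sumn r)%N.
  by elim: r => //= n r IHr /andP[n0 /IHr r0]; rewrite -add1n leq_add.
elim: sh => //= n sh IHsh /andP[n0 sh0] e.
have n1 : n = 1%N.
  apply/eqP; rewrite eqn_leq n0 andbT -(leq_add2r (size sh)) add1n -e.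
  by rewrite leq_add2l le.
by rewrite n1 {1}IHsh //; apply/eqP; rewrite -eqSS -e n1.
Qed.

Lemma reshape_nseq1 s : reshape (nseq (size s) 1%N) s = [seq [:: x] | x <- s].
Proof. by elim: s => //= x s <-; rewrite take0 drop0. Qed.

Lemma comp_top F (al : seq B -> B) s : (forall x, al [:: x] = x) ->
  comp F al s =
  \sum_(k < size s) \sum_(q : k.-tuple 'I_(size s).+1 | is_composition q)
    F [seq al u | u <- reshape [seq val i | i <- q] s] + F s.
Proof.
move=> al1; rewrite /comp big_ord_recr /=; congr (_ + _).
pose q0 := [tuple (inord 1 : 'I_(size s).+1) | i < size s].
have vq0 : [seq val i | i <- q0] = nseq (size s) 1%N.
  apply: (@eq_from_nth _ 0%N) => [|i].
    by rewrite size_map size_tuple size_nseq.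
  rewrite size_map size_tuple => lt_i; rewrite nth_nseq lt_i.
  rewrite (nth_map ord0) ?size_tuple //.
  rewrite -(tnth_nth ord0 q0 (Ordinal lt_i)) tnth_mktuple /= inordK //.
  by rewrite ltnS (leq_ltn_trans _ lt_i).
rewrite (big_pred1 q0) => [|q].
  rewrite vq0 reshape_nseq1 -map_comp; congr (ms_fun F _).
  by rewrite -[RHS]map_id; apply: eq_map => x /=; rewrite al1.
apply/idP/eqP => [/andP[q_gt0 /eqP sq]|->]; last first.
  apply/andP; split; last by rewrite vq0 sumn_nseq mul1n.
  have: all (leq 1) [seq val i | i <- q0] by rewrite vq0 all_nseq orbT.
  by rewrite all_map.
apply/val_inj/(inj_map val_inj); rewrite vq0 /=.
have sz : size [seq val i | i <- q] = size s by rewrite size_map size_tuple.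
by rewrite (@all1_sumn [seq val i | i <- q]) ?sz // all_map.
Qed.

Lemma ms_fixpoint (Phi : mseries B -> mseries B) :
  (forall F G s, (forall t, (size t < size s)%N -> F t = G t) ->
                 Phi F s = Phi G s) ->
  exists! F, F = Phi F.
Proof.
move=> ctr; pose it n := iter n Phi 0.
have stab n m m' s : (size s < n)%N -> (n <= m)%N -> (n <= m')%N -> it m s = it m' s.
  elim: n m m' s => // n IHn [|m] [|m'] s //= sn nm nm'.
  by apply: ctr => t ts; apply: IHn => //; apply: leq_trans ts _.
have fixP : multilinear (fun s => it (size s).+1 s).
  by move=> s t c x y; rewrite !size_cat /= ms_multilinear.
pose F := MSeries fixP; exists F; split=> [|G eG]; apply: msP => s.
  rewrite [LHS]/=; apply: ctr => t ts.
  exact: (stab (size t).+1 (size s) (size t).+1 t).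
have [n] := ubnP (size s); elim: n s => // n IHn s sn.
rewrite eG [LHS]/=; apply: ctr => t ts; rewrite -IHn ?(leq_trans ts) //.
exact: (stab (size t).+1 (size s) (size t).+1 t).
Qed.

Lemma exists_comp (D al : mseries B) : (forall x, al [:: x] = x) ->
  exists! F, ms_comp F al = D.
Proof.
move=> al1; have [F G s eFG|F [eF uF]] :=
  @ms_fixpoint (fun F => D - (ms_comp F al - F)).
  rewrite !msB /= !comp_top // !addrK; congr (_ - _).
  apply: eq_bigr => k _; apply: eq_bigr => q _; apply: eFG.
  by rewrite size_map size_reshape size_map size_tuple.
have fixE G : (G = D - (ms_comp G al - G)) <-> ms_comp G al = D.
  rewrite opprB addrA [D + G]addrC -addrA; split=> [/eqP|->].
    by rewrite -subr_eq0 opprD addrA subrr add0r oppr_eq0 subr_eq0 => /eqP.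
  by rewrite subrr addr0.
exists F; split=> [|G /fixE /uF //]; exact/fixE.
Qed.

Lemma exists_H G : G [::] = 1 ->
  exists! H, C0 H /\ H = ms_comp G (ms_I * H).
Proof.
move=> G1; have [F F' s eFF'|H [eH uH]] :=
  @ms_fixpoint (fun H => ms_comp G (ms_I * H)).
  by apply: eq_compr => -[|x u] us; rewrite ?ms_IMnil // !ms_IMcons eFF'.
exists H; split=> [|H' [_ /uH]//]; split=> //.
by rewrite /C0 /= eH comp_nil.
Qed.

End Series.

Arguments C0 {K} B.
Arguments ms_I {K} B.
Arguments ms_E {K} B.

Notation "F \oS G" := (ms_comp F G)
  (at level 50, left associativity) : ring_scope.

Section Spaces.
Variables (K : fieldType) (B A : algType K) (iota : {lrmorphism B -> A}).
Implicit Types (phi psi chi : {linear A -> B}) (x y : A).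
Local Notation I := (ms_I B).
Local Notation E := (ms_E B).

(* B is regarded as a subalgebra of A through iota.                           *)
Definition unital_bimodule_map chi : Prop :=
  chi 1 = 1 /\ forall b x b', chi (iota b * x * iota b') = b * chi x * b'.

Inductive gen_subalg x : A -> Prop :=
| gen_subalg_base b : gen_subalg x (iota b)
| gen_subalg_gen : gen_subalg x x
| gen_subalg_scale c p : gen_subalg x p -> gen_subalg x (c *: p)
| gen_subalg_add p q : gen_subalg x p -> gen_subalg x q -> gen_subalg x (p + q)
| gen_subalg_mul p q : gen_subalg x p -> gen_subalg x q -> gen_subalg x (p * q).

(* The two indices are the booleans. The empty product is excluded, since     *)
(* psi 1 = 1.                                                                 *)
Definition cond_free phi psi (x1 x2 : A) : Prop :=
  forall (n : nat) (i : nat -> bool) (p : nat -> A), (0 < n)%N ->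
    (forall j, (j < n)%N -> gen_subalg (if i j then x1 else x2) (p j)) ->
    (forall j, (j < n)%N -> psi (p j) = 0) ->
    (forall j, (j.+1 < n)%N -> i j != i j.+1) ->
    psi (\prod_(j < n) p j) = 0 /\
    phi (\prod_(j < n) p j) = \prod_(j < n) phi (p j).

Fact moment_multilinear chi x : multilinear (fun s : seq B =>
  if s is b0 :: s' then chi (iota b0 * \prod_(b <- s') (x * iota b)) else 0).
Proof.
case=> [|b0 s] t c u v /=.
  by rewrite linearP mulrDl -scalerAl linearP.
rewrite !big_cat !big_cons /= -linearP; congr (chi _).
by rewrite linearP mulrDr -scalerAr !mulrDl -!scalerAl !mulrDr -!scalerAr.
Qed.

Definition moment_series chi x : mseries B := MSeries (moment_multilinear chi x).

Definition K_series psi x : mseries B :=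
  let Cpsi := moment_series psi x in
  the_series [set F | C0 B F /\ Cpsi = I + I * (F \oS Cpsi) * Cpsi].

Definition Kc_series phi psi x : mseries B :=
  let Cpsi := moment_series psi x in
  let Cphi := moment_series phi x in
  the_series [set F | C0 B F /\ Cphi = I + I * (F \oS Cpsi) * Cphi].

Definition T_series psi x : mseries B :=
  let Kx := K_series psi x in
  the_series [set T | C0 B T /\ Kx = T \oS (I * Kx)].

Definition Tc_series phi psi x : mseries B :=
  let Kx := K_series psi x in
  the_series [set T | C0 B T /\ Kc_series phi psi x = T \oS (I * Kx)].

Definition H_series psi x : mseries B :=
  the_series [set H | C0 B H /\ H = (T_series psi x \oS E) \oS (I * H)].

Definition Hc_series phi psi x : mseries B :=
  (Tc_series phi psi x \oS E) \oS (I * H_series psi x).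

Definition H_vdash psi x y : mseries B :=
  the_series [set H | C0 B H /\
    H = (T_series psi x \oS E) \oS (H_series psi y * I) \oS (I * H)].

Definition H_dashv psi x y : mseries B :=
  H_series psi y \oS (I * H_vdash psi x y).

Lemma moment_factor chi x : unital_bimodule_map chi -> chi x = 1 ->
  exists2 M : mseries B, M [::] = 1 & moment_series chi x = I + I * M * I.
Proof.
move=> [chi1 chiB] chix.
have Mlin : multilinear (fun s : seq B => chi (x * \prod_(b <- s) (iota b * x))).
  move=> s t c u v; rewrite !big_cat !big_cons /= -linearP; congr (chi _).
  by rewrite linearP !mulrDl -!scalerAl !mulrDr -!scalerAr.
exists (MSeries Mlin); first by rewrite /= big_nil mulr1.
apply: msP => -[|b0 s]; rewrite msD.
  by rewrite ms_MInil addr0.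
case/lastP: s => [|s b].
  rewrite (ms_MIrcons _ [::]) ms_IMnil mul0r addr0 /= big_nil -(mulr1 b0).
  by rewrite -[iota _]mulr1 -(rmorph1 iota) chiB rmorph1 chi1 !mulr1.
rewrite -rcons_cons ms_MIrcons ms_IMcons.
have -> : I (b0 :: rcons s b) = 0 by case: s.
rewrite add0r /= -chiB; congr (chi _); rewrite -cats1 big_cat big_seq1 /= !mulrA.
congr (_ * _); rewrite -!mulrA; congr (_ * _).
elim: s => [|u s IHs]; first by rewrite !big_nil mul1r mulr1.
by rewrite !big_cons -!mulrA IHs.
Qed.

Lemma exists_cumulant (N M : mseries B) : M [::] = 1 ->
  exists! F, C0 B F /\
    I + I * M * I = I + I * (F \oS (I + I * N * I)) * (I + I * M * I).
Proof.
move=> M1; have [F G s FG|D [eD uD]] :=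
  @ms_fixpoint _ _ (fun D => M - D * (I * M)).
  rewrite !msB; congr (_ - _); rewrite !msM /cauchy !big_ord_recr /= drop_size.
  rewrite -[cauchy _ _ _]/((I * M) [::]) ms_IMnil !mulr0 !addr0.
  by apply: eq_bigr => k _; rewrite FG // size_take ltn_ord.
have fixE G : G = M - G * (I * M) <->
    I + I * M * I = I + I * G * (I + I * M * I).
  have -> : I * G * (I + I * M * I) = I * (G + G * (I * M)) * I.
    by rewrite !mulrDr mulrDl !mulrA.
  split=> [e|/addrI/ms_mulIr/ms_mulIl e]; last by rewrite {1}e addrK.
  by have -> : G + G * (I * M) = M by rewrite {1}e subrK.
have [|F [eF uF]] := @exists_comp _ _ D (I + I * N * I).
  by move=> u; rewrite msD -mulrA ms_IMcons ms_MInil mulr0 addr0.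
exists F; split=> [|G [_ /fixE/uD eG]]; last by apply: uF; rewrite -eG.
split; last by rewrite eF; apply/fixE.
rewrite /C0 /= -(comp_nil F (I + I * N * I)) eF eD msB msM.
by rewrite cauchy_nil ms_IMnil mulr0 subr0.
Qed.

Section WellDefined.
Variables (phi psi : {linear A -> B}) (x : A).
Hypotheses (phiB : unital_bimodule_map phi) (psiB : unital_bimodule_map psi).
Hypotheses (phix : phi x = 1) (psix : psi x = 1).

Lemma K_seriesP :
  exists! F, C0 B F /\ moment_series psi x =
    I + I * (F \oS moment_series psi x) * moment_series psi x.
Proof. by have [M M1 ->] := moment_factor psiB psix; apply: exists_cumulant. Qed.

Lemma Kc_seriesP :
  exists! F, C0 B F /\ moment_series phi x =
    I + I * (F \oS moment_series psi x) * moment_series phi x.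
Proof.
have [M M1 ->] := moment_factor phiB phix.
by have [N _ ->] := moment_factor psiB psix; apply: exists_cumulant.
Qed.

Lemma K_series1 : C0 B (K_series psi x).
Proof. by have [] := the_seriesP K_seriesP. Qed.

Lemma Kc_series1 : C0 B (Kc_series phi psi x).
Proof. by have [] := the_seriesP Kc_seriesP. Qed.

Lemma exists_T (F : mseries B) : C0 B F ->
  exists! T, C0 B T /\ F = T \oS (I * K_series psi x).
Proof.
move=> F1; have [|T [eT uT]] := @exists_comp _ _ F (I * K_series psi x).
  by move=> u; rewrite ms_IMcons K_series1 mulr1.
exists T; split=> [|T' [_ /esym/uT]//]; split=> //.
by rewrite /C0 /= -(comp_nil T (I * K_series psi x)) eT.
Qed.

Lemma T_seriesP :
  exists! T, C0 B T /\ K_series psi x = T \oS (I * K_series psi x).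
Proof. exact: exists_T K_series1. Qed.

Lemma Tc_seriesP :
  exists! T, C0 B T /\ Kc_series phi psi x = T \oS (I * K_series psi x).
Proof. exact: exists_T Kc_series1. Qed.

Lemma T_series1 : C0 B (T_series psi x).
Proof. by have [] := the_seriesP T_seriesP. Qed.

Lemma H_seriesP :
  exists! H, C0 B H /\ H = (T_series psi x \oS E) \oS (I * H).
Proof. by apply: exists_H; rewrite comp_nil T_series1. Qed.

Lemma H_vdashP y : exists! H, C0 B H /\
  H = (T_series psi x \oS E) \oS (H_series psi y * I) \oS (I * H).
Proof. by apply: exists_H; rewrite !comp_nil T_series1. Qed.

End WellDefined.

End Spaces.

(* Main.v *)
Require Import Defs.
From HB Require Import structures.
From mathcomp Require Import all_boot all_order all_algebra.
From mathcomp Require Import boolp classical_sets reals complex.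

Import GRing.Theory.
Local Open Scope ring_scope.

Set Implicit Arguments.
Unset Strict Implicit.
Unset Printing Implicit Defensive.

(* In the indeterminate z = I, write C for the moment series of x. Solving    *)
(* the equations for K, T and H shows H_x = K_x o C^psi and H^c_x = K^c_x o   *)
(* C^psi, so that C^psi = I + I H_x C^psi and C^phi = I + I H^c_x C^phi:      *)
(* H_x and H^c_x are the Boolean cumulant series of x.                        *)
(*                                                                            *)
(* Let V = H_(a|-b), D = H_(a-|b), u = D z, v = z V. The defining equations   *)
(* say that V = H_a o u and D = H_b o v, which makes the series               *)
(*   a' = (1 - a u)^-1 (a - V)   and   b' = (b - D) (1 - v b)^-1              *)
(* psi-centred, with coefficients in <a> and <b>. On the other hand           *)
(*   1 - a b z =                                                              *)
(*     (1 - a u) [(1 - V u)^-1 - a' (1 - u V)^-1 b' z] (1 - V b z),           *)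
(* so (1 - a b z)^-1 is a sum of alternating products of a' and b' with       *)
(* coefficients in B, on which phi is multiplicative. Applying phi replaces   *)
(* a and b by H^c_a o u and H^c_b o v in this identity, that is, the phi-image*)
(* of (1 - a b z)^-1 is (1 - (H^c_a o u)(H^c_b o v) z)^-1; it is also         *)
(* (1 - H^c_(ab) z)^-1.                                                       *)

(** * Formal power series in noncommuting letters *)

(** Conditional freeness only controls alternating products of [psi]-centred elements, so the
    resolvent of [a * b] has to be expanded in such products. D and V are the corrections that
    centre the resolvents of [a] and [b] at u and v: D = H_b o v is a definition, V = H_a o u is
    [H_vdashE], and the two together are the last two identities of the theorem. By the Boolean
    recursions they make a' and b' centred ([centered_centering_a], [centered_centering_b]).

    The factorization [factor_product] is pure ring theory and uses of a' and b' only (1 - a u) a' =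
    a - V and b' (1 - v b) = b - D. The [phi]-images of a' and b' satisfy the same relations with
    H^c_a o u and H^c_b o v in place of [a] and [b] ([image_centering_a], [image_centering_b]). The
    identity therefore serves twice: over A to expand the resolvent, over B to resum its image
    ([phi_N]). In between, [right_free] carries [phi] through the expansion, and [Hc_series_mul]
    compares inverses. *)

Section Splittings.
Variables (T : Type) (W : zmodType).
Implicit Types (f g : seq T -> seq T -> W) (s : seq T).

Definition split_sum f s : W :=
  \sum_(k < (size s).+1) f (take k s) (drop k s).

Lemma split_sum_nil f : split_sum f [::] = f [::] [::].
Proof. by rewrite /split_sum big_ord1. Qed.

Lemma split_sum_cons f x s :
  split_sum f (x :: s) =
  f [::] (x :: s) + split_sum (fun u v => f (x :: u) v) s.
Proof. by rewrite /split_sum big_ord_recl. Qed.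

Lemma eq_split_sum f g s :
  (forall u v, u ++ v = s -> f u v = g u v) -> split_sum f s = split_sum g s.
Proof. by move=> fg; apply: eq_bigr => k _; apply/fg/cat_take_drop. Qed.

Lemma split_sumD f g s :
  split_sum (fun u v => f u v + g u v) s = split_sum f s + split_sum g s.
Proof. exact: big_split. Qed.

(** Both sides run over the ways to cut [s] into three consecutive pieces. *)
Lemma split_sumA (h : seq T -> seq T -> seq T -> W) s :
  split_sum (fun u v => split_sum (fun u1 u2 => h u1 u2 v) u) s =
  split_sum (fun u v => split_sum (h u) v) s.
Proof.
elim: s h => [|x s IHs] h; first by rewrite !split_sum_nil.
rewrite !split_sum_cons split_sum_nil -addrA -IHs -split_sumD; congr (_ + _).
by apply: eq_split_sum => u v _; rewrite split_sum_cons.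
Qed.

End Splittings.

Lemma raddf_split_sum (T : Type) (W W' : zmodType) (chi : {additive W -> W'})
    (f : seq T -> seq T -> W) s :
  chi (split_sum f s) = split_sum (fun u v => chi (f u v)) s.
Proof. exact: raddf_sum. Qed.

(** Arbitrary functions on words: series with values in A are needed beside those in B, and
    multilinearity matters only for the associativity of composition. *)
Definition ncs (T : Type) (W : pzRingType) : Type := seq T -> W.

HB.instance Definition _ T W := gen_eqMixin (ncs T W).
HB.instance Definition _ T W := gen_choiceMixin (ncs T W).

Section NcsRing.
Variables (T : Type) (W : pzRingType).
Implicit Types (F G H : ncs T W) (s : seq T).

Let ncs_zero : ncs T W := fun=> 0.
Let ncs_opp F : ncs T W := fun s => - F s.
Let ncs_add F G : ncs T W := fun s => F s + G s.
Let ncs_one : ncs T W := fun s => if s is [::] then 1 else 0.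
Let ncs_mul F G : ncs T W := split_sum (fun u v => F u * G v).

Fact ncs_addA : associative ncs_add.
Proof. by move=> F G H; apply: funext => s; apply: addrA. Qed.
Fact ncs_addC : commutative ncs_add.
Proof. by move=> F G; apply: funext => s; apply: addrC. Qed.
Fact ncs_add0 : left_id ncs_zero ncs_add.
Proof. by move=> F; apply: funext => s; apply: add0r. Qed.
Fact ncs_addN : left_inverse ncs_zero ncs_opp ncs_add.
Proof. by move=> F; apply: funext => s; apply: addNr. Qed.

HB.instance Definition _ :=
  GRing.isZmodule.Build (ncs T W) ncs_addA ncs_addC ncs_add0 ncs_addN.

Fact ncs_mulA : associative ncs_mul.
Proof.
move=> F G H; apply: funext => s; rewrite /ncs_mul.
transitivity (split_sum (fun u v => split_sum (fun v1 v2 => F u * G v1 * H v2) v) s).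
  apply: eq_split_sum => u v _; rewrite /split_sum mulr_sumr.
  by apply: eq_bigr => k _; rewrite /= mulrA.
rewrite -split_sumA; apply: eq_split_sum => u v _.
by rewrite /split_sum mulr_suml.
Qed.
Fact ncs_mul1l : left_id ncs_one ncs_mul.
Proof.
move=> F; apply: funext => -[|x s].
  by rewrite [LHS]split_sum_nil mul1r.
rewrite [LHS]split_sum_cons mul1r /split_sum big1 ?addr0 // => k _.
by rewrite mul0r.
Qed.
Fact ncs_mul1r : right_id ncs_one ncs_mul.
Proof.
move=> F; apply: funext => s; rewrite /ncs_mul.
elim: s F => [|x s IHs] F; first by rewrite split_sum_nil mulr1.
by rewrite split_sum_cons mulr0 add0r (IHs (fun t => F (x :: t))).
Qed.
Fact ncs_mulDl : left_distributive ncs_mul +%R.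
Proof.
move=> F G H; apply: funext => s; rewrite -[RHS]split_sumD.
by apply: eq_split_sum => u v _; apply: mulrDl.
Qed.
Fact ncs_mulDr : right_distributive ncs_mul +%R.
Proof.
move=> F G H; apply: funext => s; rewrite -[RHS]split_sumD.
by apply: eq_split_sum => u v _; apply: mulrDr.
Qed.

HB.instance Definition _ := GRing.Zmodule_isPzRing.Build (ncs T W)
  ncs_mulA ncs_mul1l ncs_mul1r ncs_mulDl ncs_mulDr.

Lemma ncsM F G s : (F * G) s = split_sum (fun u v => F u * G v) s.
Proof. by []. Qed.

Lemma ncsM_nil F G : (F * G) [::] = F [::] * G [::].
Proof. exact: split_sum_nil. Qed.

Lemma ncs_sumE (I : Type) (r : seq I) (P : pred I) (f : I -> ncs T W) s :
  (\sum_(i <- r | P i) f i) s = \sum_(i <- r | P i) f i s.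
Proof. exact: (big_morph (fun F : ncs T W => F s)). Qed.

Lemma ncsX_small F n s : F [::] = 0 -> (size s < n)%N -> (F ^+ n) s = 0.
Proof.
move=> F0; elim: n s => // n IHn s sn; rewrite exprS ncsM /split_sum big1 // => k _.
case: s k sn => [|x s] [[|k] lt_k] sn /=; rewrite ?F0 ?mul0r //.
by rewrite IHn ?mulr0 // size_drop -ltnS (leq_ltn_trans _ sn) // ltnS leq_subr.
Qed.

(** The inverse of 1 - F as a geometric series. Truncating it is harmless when F has no constant
    term, since F^n then vanishes on words shorter than n. *)
Definition ncs_star F : ncs T W := fun s => \sum_(n < (size s).+1) (F ^+ n) s.

Lemma ncs_starE F s m : F [::] = 0 -> (size s < m)%N ->
  ncs_star F s = (\sum_(n < m) F ^+ n) s.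
Proof.
move=> F0 sm; rewrite ncs_sumE /ncs_star.
rewrite -!(big_mkord predT (fun n => (F ^+ n) s)).
rewrite [RHS](big_cat_nat (n := (size s).+1)) //= [X in _ + X]big_nat_cond.
rewrite [X in _ + X]big1 ?addr0 // => n; rewrite andbT => /andP[sn _].
by rewrite ncsX_small.
Qed.

Lemma ncs_starP F : F [::] = 0 ->
  (1 - F) * ncs_star F = 1 /\ ncs_star F * (1 - F) = 1.
Proof.
move=> F0; have X0 s : (1 - F ^+ (size s).+1) s = (1 : ncs T W) s.
  by rewrite -[LHS]/(_ + - _) ncsX_small // oppr0 addr0.
have starE u v s : u ++ v = s ->
    ncs_star F u = (\sum_(n < (size s).+1) F ^+ n) u /\
    ncs_star F v = (\sum_(n < (size s).+1) F ^+ n) v.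
  move=> <-; rewrite size_cat.
  by split; apply: ncs_starE; rewrite // ltnS ?leq_addr ?leq_addl.
split; apply: funext => s; rewrite -X0.
  rewrite -[_ - F ^+ _]opprB subrX1 -mulNr opprB !ncsM.
  by apply: eq_split_sum => u v /starE[_ ->].
rewrite -[_ - F ^+ _]opprB subrX1 -mulNr opprB.
have <- : (\sum_(n < (size s).+1) F ^+ n) * (1 - F) =
          (1 - F) * \sum_(n < (size s).+1) F ^+ n.
  by rewrite mulrBl mulrBr mul1r mulr1 mulr_sumr mulr_suml; congr (_ - _);
     apply: eq_bigr => n _; rewrite -exprS exprSr.
by apply: eq_split_sum => u v /starE[-> _].
Qed.

Lemma ncs_star_linv F G : G [::] = 0 -> ncs_star (F * G) * (1 - F * G) = 1.
Proof. by move=> G0; have [] := @ncs_starP (F * G) _; rewrite ?ncsM_nil ?G0 ?mulr0. Qed.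

End NcsRing.

(** * Composition of series *)

Section Compositions.

Definition compositions (n : nat) : seq (seq nat) :=
  [seq [seq val i | i <- tval q] | k <- iota 0 n.+1,
     q <- [seq q <- enum {: k.-tuple 'I_n.+1} | is_composition q]].

Lemma mem_compositions n c :
  (c \in compositions n) = all (leq 1) c && (sumn c == n).
Proof.
apply/allpairsPdep/andP => [[k [q [_]]]|[c_gt0 /eqP cn]].
  by rewrite mem_filter => /andP[/andP[q0 qn] _] ->; rewrite all_map.
have le_size r : all (leq 1) r -> (size r <= sumn r)%N.
  by elim: r => //= m r IHr /andP[m0 /IHr r0]; rewrite -add1n leq_add.
have le_mem m : m \in c -> (m <= n)%N.
  rewrite -cn; elim: (c) => //= p r IHr; rewrite inE => /orP[/eqP->|/IHr mr].
    exact: leq_addr.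
  exact: leq_trans mr (leq_addl _ _).
pose q := [tuple of [seq inord m : 'I_n.+1 | m <- in_tuple c]].
have qc : [seq val i | i <- q] = c.
  rewrite -map_comp -[RHS]map_id; apply/eq_in_map => m /le_mem mn /=.
  by rewrite inordK.
exists (size c), q; split=> //.
  by rewrite mem_iota add0n ltnS -cn le_size.
rewrite mem_filter mem_enum andbT /is_composition qc cn eqxx andbT.
by have := c_gt0; rewrite -{1}qc all_map.
Qed.

Lemma uniq_compositions n : uniq (compositions n).
Proof.
apply: allpairs_uniq_dep => [|k _|]; first exact: iota_uniq.
  by apply: filter_uniq; apply: enum_uniq.
move=> [k q] [k' q'] _ _ /= qq'.
have kk' : k = k'.
  by rewrite -(size_tuple q) -(size_map val q) qq' size_map size_tuple.
case: _ / kk' q' qq' => q' /(inj_map val_inj) qq'.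
by congr (Tagged _ _); apply: val_inj.
Qed.

(** Splits off the first part. The lists agree only up to order because [compositions] enumerates by
    number of parts. *)
Lemma compositionsS n : perm_eq (compositions n.+1)
  [seq k.+1 :: c | k <- iota 0 n.+1, c <- compositions (n - k)].
Proof.
apply: uniq_perm (uniq_compositions _) _ _.
  apply: allpairs_uniq_dep => [|k _|]; first exact: iota_uniq.
    exact: uniq_compositions.
  by move=> [k c] [k' c'] _ _ /= [-> ->].
move=> c; rewrite mem_compositions; apply/andP/allpairsPdep.
  case: c => [|[|k] c] /=; [by case | by case | case=> c0 /eqP[cn]].
  exists k, c; rewrite -[0%N :: _]/(iota 0 n.+1) mem_iota mem_compositions c0.
  by rewrite -cn addKn eqxx add0n ltnS leq_addr.
move=> [k [d [kn]]]; rewrite mem_compositions => /andP[d0 /eqP dn] -> /=.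
by move: kn; rewrite mem_iota d0 dn addSn ltnS => kn; rewrite subnKC.
Qed.

End Compositions.

Section Composition.
Variables (T U : Type) (W : zmodType).
Implicit Types (F G : seq U -> W) (al : seq T -> U) (s : seq T).

Definition compose F al s : W :=
  \sum_(k < (size s).+1) \sum_(q : k.-tuple 'I_(size s).+1 | is_composition q)
    F [seq al u | u <- reshape [seq val i | i <- q] s].

Lemma composeE F al s :
  compose F al s =
  \sum_(c <- compositions (size s)) F [seq al u | u <- reshape c s].
Proof.
rewrite big_allpairs_dep -[iota _ _]/(index_iota 0 (size s).+1) big_mkord.
by rewrite /compose; apply: eq_bigr => k _; rewrite big_filter big_enum_cond.
Qed.

Lemma compose_nil F al : compose F al [::] = F [::].
Proof.
rewrite composeE (perm_big [:: [::]]) ?big_seq1 //.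
apply: uniq_perm (uniq_compositions _) _ _ => // -[|[|k] c];
by rewrite mem_compositions ?inE //= andbF.
Qed.

Lemma compose_cons F al x s :
  compose F al (x :: s) =
  split_sum (fun u v => compose (fun t => F (al (x :: u) :: t)) al v) s.
Proof.
rewrite composeE (perm_big _ (compositionsS _)) big_allpairs_dep.
rewrite -[iota _ _]/(index_iota 0 (size s).+1) big_mkord.
by apply: eq_bigr => k _; rewrite composeE size_drop.
Qed.

Lemma eq_compose F G al : F =1 G -> compose F al =1 compose G al.
Proof. by move=> FG s; do 2!apply: eq_bigr => ? _; apply: FG. Qed.

Lemma composeD F G al s :
  compose (fun t => F t + G t) al s = compose F al s + compose G al s.
Proof. by rewrite !composeE big_split. Qed.

Lemma compose_sum I (r : seq I) (Q : pred I) (f : I -> seq U -> W) al s :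
  compose (fun t => \sum_(i <- r | Q i) f i t) al s =
  \sum_(i <- r | Q i) compose (f i) al s.
Proof. by rewrite composeE exchange_big; apply: eq_bigr => i _; rewrite composeE. Qed.

Lemma compose0 al s : compose (fun=> 0) al s = 0 :> W.
Proof. by rewrite composeE big1. Qed.

End Composition.

Lemma raddf_compose T U (W W' : zmodType) (chi : {additive W -> W'})
    (F : seq U -> W) (al : seq T -> U) s :
  chi (compose F al s) = compose (fun t => chi (F t)) al s.
Proof. by rewrite !composeE raddf_sum. Qed.

Section Pairing.
Variables (T U : Type) (W W' : zmodType) (P : W -> seq U -> W').
Hypothesis PD : forall x y t, P (x + y) t = P x t + P y t.

Lemma pairing_sum I (r : seq I) (Q : pred I) (f : I -> W) t :
  P (\sum_(i <- r | Q i) f i) t = \sum_(i <- r | Q i) P (f i) t.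
Proof.
apply: (big_morph (P^~ t)) => [x y|]; first exact: PD.
by apply: (addrI (P 0 t)); rewrite -PD !addr0.
Qed.

(* Composition is compatible with every biadditive pairing of the values; the *)
(* Cauchy product and the insertion of a value in the first slot of a         *)
(* multilinear map are both of this form.                                     *)
Lemma compose_pairing (f : seq U -> W) (al : seq T -> U) s :
  compose (split_sum (fun u v => P (f u) v)) al s =
  split_sum (fun u v => compose (P (compose f al u)) al v) s.
Proof.
have [n] := ubnP (size s); elim: n s f => // n IHn [|x s] f sn.
  by rewrite compose_nil !split_sum_nil !compose_nil.
rewrite compose_cons split_sum_cons compose_nil.
under eq_split_sum => u v _.
  rewrite (eq_compose _ (fun t => split_sum_cons _ _ _)) composeD.
over.
rewrite split_sumD -compose_cons; congr (_ + _).
under eq_split_sum => u v uv.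
  rewrite (IHn _ (fun w => f (al (x :: u) :: w))); first over.
  by rewrite -ltnS (leq_trans _ sn) // -uv /= size_cat !ltnS leq_addl.
rewrite -split_sumA; apply: eq_split_sum => u v _.
rewrite compose_cons {1}/split_sum -compose_sum; apply: eq_compose => t.
by rewrite /split_sum pairing_sum.
Qed.

End Pairing.

Definition multiadditive (V W : zmodType) (F : seq V -> W) : Prop :=
  forall s t x y, F (s ++ (x + y) :: t) = F (s ++ x :: t) + F (s ++ y :: t).

(** Induction on the word, peeling off the first block. Its value under [compose al be] is a sum,
    which multiadditivity of [F] takes out of the first slot; [compose_pairing] does the
    bookkeeping. *)
Lemma composeA (T U : Type) (V W : zmodType) (F : seq V -> W)
    (al : seq U -> V) (be : seq T -> U) s : multiadditive F ->
  compose (compose F al) be s = compose F (compose al be) s.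
Proof.
have [n] := ubnP (size s); elim: n s F => // n IHn [|x s] F sn FD.
  by rewrite !compose_nil.
have FxD y : multiadditive (fun t => F (y :: t)).
  by move=> s1 t y1 y2; apply: (FD (y :: s1)).
pose P y := compose (fun t => F (y :: t)) al.
pose P' y := compose (fun t => F (y :: t)) (compose al be).
have PD y z t : P (y + z) t = P y t + P z t.
  by rewrite -composeD; apply: eq_compose => w; apply: (FD [::]).
have PD' y z t : P' (y + z) t = P' y t + P' z t.
  by rewrite -composeD; apply: eq_compose => w; apply: (FD [::]).
rewrite !compose_cons.
transitivity (split_sum (fun u v => split_sum (fun v1 v2 =>
    P' (compose (fun w => al (be (x :: u) :: w)) be v1) v2) v) s).
  apply: eq_split_sum => u v uv.
  rewrite (eq_compose _ (fun t => compose_cons F al (be (x :: u)) t)).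
  rewrite (compose_pairing PD); apply: eq_split_sum => v1 v2 v12.
  apply: IHn => //.
  by rewrite -ltnS (leq_trans _ sn) // -uv -v12 /= !size_cat !ltnS addnA leq_addl.
rewrite -split_sumA; apply: eq_split_sum => u v _.
by rewrite compose_cons -[RHS]/(P' _ _) /split_sum (pairing_sum PD').
Qed.

Lemma split_sum_last (T : Type) (W : zmodType) (f : seq T -> seq T -> W) s :
  (forall u y v, f u (y :: v) = 0) -> split_sum f s = f s [::].
Proof.
elim: s f => [|x s IHs] f f0; first exact: split_sum_nil.
by rewrite split_sum_cons f0 add0r IHs.
Qed.

Section Letters.
Variables (T : Type) (W : pzRingType).
Implicit Types F G A : ncs T W.

Definition ncs_const (w : W) : ncs T W := fun s => if s is [::] then w else 0.

Definition ncs_letter (g : T -> W) : ncs T W :=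
  fun s => if s is [:: x] then g x else 0.

Lemma ncs_constM w F s : (ncs_const w * F) s = w * F s.
Proof.
case: s => [|x s]; rewrite ncsM ?split_sum_nil ?split_sum_cons //=.
by rewrite /split_sum big1 ?addr0 // => k _; rewrite mul0r.
Qed.

Lemma ncs_const_mul v w : ncs_const (v * w) = ncs_const v * ncs_const w.
Proof. by apply: funext => -[|x s]; rewrite ncs_constM //= mulr0. Qed.

Lemma ncs_letterM_nil g F : (ncs_letter g * F) [::] = 0.
Proof. by rewrite ncsM_nil mul0r. Qed.

Lemma ncs_letterM_cons g F x s : (ncs_letter g * F) (x :: s) = g x * F s.
Proof.
rewrite ncsM split_sum_cons mul0r add0r -[RHS]ncs_constM.
by apply: eq_split_sum => -[|y u].
Qed.

Lemma ncs_Mletter_rcons g F s x : (F * ncs_letter g) (rcons s x) = F s * g x.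
Proof.
rewrite ncsM; elim: s F => [|y s IHs] F /=; rewrite split_sum_cons.
  by rewrite split_sum_nil mulr0 addr0.
rewrite (IHs (fun t => F (y :: t))) /=.
by case: s {IHs} => [|? ?] /=; rewrite mulr0 add0r.
Qed.

Lemma ncs_fixpoint_uniq A F G G' : F [::] = 0 ->
  G = A + F * G -> G' = A + F * G' -> G = G'.
Proof.
move=> F0 eG eG'; have [_ starK] := ncs_starP F0.
have fixE X : X = A + F * X -> X = ncs_star F * A.
  by move=> eX; rewrite -[LHS]mul1r -starK -mulrA mulrBl mul1r {1}eX addrK.
by rewrite (fixE G) // (fixE G').
Qed.

End Letters.

Section NcsMap.
Variables (T : Type) (W W' : pzRingType).

Definition ncs_map (f : W -> W') (F : ncs T W) : ncs T W' := fun s => f (F s).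

Lemma ncs_mapD (f : {additive W -> W'}) : {morph ncs_map f : F G / F + G}.
Proof. by move=> F G; apply: funext => s; apply: raddfD. Qed.

Lemma ncs_mapB (f : {additive W -> W'}) : {morph ncs_map f : F G / F - G}.
Proof. by move=> F G; apply: funext => s; apply: raddfB. Qed.

Lemma ncs_mapM (f : {rmorphism W -> W'}) : {morph ncs_map f : F G / F * G}.
Proof.
move=> F G; apply: funext => s; rewrite /ncs_map !ncsM raddf_split_sum.
by apply: eq_split_sum => u v _; apply: rmorphM.
Qed.

Lemma ncs_map1 (f : {rmorphism W -> W'}) : ncs_map f 1 = 1.
Proof. by apply: funext => -[|x s]; [apply: rmorph1 | apply: rmorph0]. Qed.

End NcsMap.

Section NcsCompose.
Variables (T U : Type) (W : pzRingType).
Implicit Types (F G : ncs U W) (al : seq T -> U).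

Definition ncs_comp F al : ncs T W := compose F al.

Lemma ncs_compD F G al : ncs_comp (F + G) al = ncs_comp F al + ncs_comp G al.
Proof. by apply: funext => s; apply: composeD. Qed.

Lemma ncs_compM F G al : ncs_comp (F * G) al = ncs_comp F al * ncs_comp G al.
Proof.
apply: funext => s; rewrite /ncs_comp.
rewrite (compose_pairing (P := fun y t => y * G t)) => [|y z t]; last exact: mulrDl.
rewrite ncsM; apply: eq_split_sum => u v _.
by rewrite [compose G _ _]composeE mulr_sumr composeE.
Qed.

Lemma ncs_comp_const w al : ncs_comp (ncs_const w) al = ncs_const w.
Proof.
apply: funext => -[|x s]; rewrite /ncs_comp ?compose_nil // compose_cons.
rewrite (@split_sum_last _ _ _ s) => [|u y v]; exact: compose0.
Qed.

(** Composition never evaluates [al] at the empty word, whence the condition there. *)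
Lemma ncs_comp_letter (g : U -> W) al : g (al [::]) = 0 ->
  ncs_comp (ncs_letter g) al = (fun s => g (al s)).
Proof.
move=> g0; apply: funext => -[|x s]; rewrite /ncs_comp ?compose_nil // compose_cons.
have E y : compose (fun t => ncs_letter g (y :: t)) al = ncs_const (g y) :> ncs T W.
  by rewrite -(ncs_comp_const _ al).
by rewrite (@split_sum_last _ _ _ s) => [|u y v]; rewrite E.
Qed.

End NcsCompose.

(** * Boolean cumulants *)

Section MseriesComposition.
Variables (K : fieldType) (B : algType K).
Implicit Types (F G al be : mseries B).
Local Notation I := (ms_I B).
Local Notation E := (ms_E B).

Definition ncs_of F : ncs B B := ms_fun F.

Lemma ncs_of_inj : injective ncs_of.
Proof. by move=> F G FG; apply: msP => s; rewrite -[F s]/(ncs_of F s) FG. Qed.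

Lemma ncs_ofD F G : ncs_of (F + G) = ncs_of F + ncs_of G. Proof. by []. Qed.
Lemma ncs_ofM F G : ncs_of (F * G) = ncs_of F * ncs_of G. Proof. by []. Qed.
Lemma ncs_of_I : ncs_of I = ncs_letter id. Proof. by []. Qed.

Lemma ms_multiadditive F : multiadditive F.
Proof. by move=> s t x y; rewrite -[x]scale1r ms_multilinear !scale1r. Qed.

Lemma ms_compA F al be : F \oS al \oS be = F \oS (al \oS be).
Proof. by apply: msP => s; apply: composeA (ms_multiadditive F). Qed.

Lemma ms_compD F G al : (F + G) \oS al = (F \oS al) + (G \oS al).
Proof. by apply: ncs_of_inj; apply: ncs_compD. Qed.

Lemma ms_compM F G al : (F * G) \oS al = (F \oS al) * (G \oS al).
Proof. by apply: ncs_of_inj; apply: ncs_compM. Qed.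

Lemma ms_compI al : al [::] = 0 -> I \oS al = al.
Proof. by move=> al0; apply: ncs_of_inj; apply: ncs_comp_letter. Qed.

Lemma ms_fixpoint_uniq F G al al' : F [::] = 0 ->
  al = G + F * al -> al' = G + F * al' -> al = al'.
Proof.
move=> F0 e e'; apply: ncs_of_inj.
apply: (@ncs_fixpoint_uniq _ _ (ncs_of G) (ncs_of F)) => //.
  by rewrite -ncs_ofM -ncs_ofD -e.
by rewrite -ncs_ofM -ncs_ofD -e'.
Qed.

Lemma ms_E_fixpoint : E = I + I * E.
Proof.
apply: msP => -[|x s]; rewrite msD.
  by rewrite ms_IMnil addr0 /= big_geq.
rewrite ms_IMcons [LHS]/= big_nat_recl //= mulr_sumr; congr (_ + _).
by apply: eq_big_nat => n /andP[n0 _]; rewrite exprS ms_IMcons.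
Qed.

Lemma comp_E al : al [::] = 0 -> E \oS al = al + al * (E \oS al).
Proof. by move=> al0; rewrite {1}ms_E_fixpoint ms_compD ms_compM ms_compI. Qed.

(** As U has no constant term, U * H in degree n involves H only below degree n, so the equation
    fixes H degree by degree. *)
Lemma comp_IM_uniq (G U H H' : mseries B) : U [::] = 0 ->
  H = G \oS (U * H) -> H' = G \oS (U * H') -> H = H'.
Proof.
move=> U0 eH eH'; apply: msP => s.
have [n] := ubnP (size s); elim: n s => // n IHn s sn.
rewrite eH eH'; apply: eq_compr => t ts; rewrite !msM.
apply: eq_bigr => -[[|k] lt_k] _ /=; first by rewrite take0 U0 !mul0r.
rewrite IHn // size_drop; case: t lt_k ts => [//|x t] _ ts /=.
by rewrite subSS (leq_ltn_trans (leq_subr _ _)) // (leq_trans ts).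
Qed.

End MseriesComposition.

Section Boolean.
Variables (K : fieldType) (B A : algType K) (iota : {lrmorphism B -> A}).
Variables (phi psi : {linear A -> B}) (x : A).
Hypotheses (phiB : unital_bimodule_map iota phi).
Hypotheses (psiB : unital_bimodule_map iota psi).
Hypotheses (phix : phi x = 1) (psix : psi x = 1).
Local Notation I := (ms_I B).
Local Notation E := (ms_E B).
Local Notation Cphi := (moment_series iota phi x).
Local Notation Cpsi := (moment_series iota psi x).
Local Notation Kx := (K_series iota psi x).
Local Notation Hx := (H_series iota psi x).

Let C0C : Cpsi [::] = 0. Proof. by []. Qed.

(** Put H' = K o C. The recursion for C, multiplied on the right by H', shows E o (I H') = C H';
    then T o (C H') = (T o (I K)) o C = H', so H' solves the equation defining [Hx]. *)
Lemma H_series_cumulant : Hx = Kx \oS Cpsi.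
Proof.
have [_ eC] := the_seriesP (K_seriesP psiB psix).
have [_ eT] := the_seriesP (T_seriesP psiB psix).
have HP := H_seriesP psiB psix; have [H [_ uH]] := HP.
rewrite /H_series -[RHS](uH _); last first.
  split; first exact: etrans (comp_nil _ _) (K_series1 psiB psix).
  set H' := Kx \oS Cpsi; rewrite ms_compA.
  have -> : E \oS (I * H') = Cpsi * H'.
    apply: (@ms_fixpoint_uniq _ _ (I * H') (I * H')); first exact: ms_IMnil.
      by rewrite {1}comp_E // ms_IMnil.
    by rewrite {1}eC mulrDl !mulrA.
  by rewrite -{1}(ms_compI C0C) /H' -ms_compM -ms_compA -eT.
exact/esym/uH/(the_seriesP HP).
Qed.

Lemma moment_IH : E \oS (I * Hx) = Cpsi * Hx.
Proof.
have [_ eC] := the_seriesP (K_seriesP psiB psix).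
apply: (@ms_fixpoint_uniq _ _ (I * Hx) (I * Hx)); first exact: ms_IMnil.
  by rewrite {1}comp_E // ms_IMnil.
by rewrite {1}eC mulrDl -/Kx -H_series_cumulant !mulrA.
Qed.

Lemma H_series_boolean : Cpsi = I + I * Hx * Cpsi.
Proof.
have [_ eC] := the_seriesP (K_seriesP psiB psix).
by rewrite H_series_cumulant.
Qed.

Lemma Hc_series_boolean : Cphi = I + I * Hc_series iota phi psi x * Cphi.
Proof.
have [_ eC] := the_seriesP (Kc_seriesP phiB psiB phix psix).
have [_ eT] := the_seriesP (Tc_seriesP phiB psiB phix psix).
suff -> : Hc_series iota phi psi x = Kc_series iota phi psi x \oS Cpsi by [].
rewrite /Hc_series ms_compA moment_IH H_series_cumulant -{1}(ms_compI C0C).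
by rewrite -ms_compM -ms_compA -eT.
Qed.

End Boolean.

Section Bimodule.
Variables (K : fieldType) (B A : algType K) (iota : {lrmorphism B -> A}).
Variables (chi : {linear A -> B}).
Hypothesis chiB : unital_bimodule_map iota chi.
Implicit Types (F G : ncs B B) (X : ncs B A).

Lemma bimodule_iota b : chi (iota b) = b.
Proof.
by case: chiB => chi1 /(_ b 1 1); rewrite chi1 !mulr1 rmorph1 mulr1.
Qed.

Lemma bimoduleMl b x : chi (iota b * x) = b * chi x.
Proof. by case: chiB => _ /(_ b x 1); rewrite rmorph1 !mulr1. Qed.

Lemma bimoduleMr x b : chi (x * iota b) = chi x * b.
Proof. by case: chiB => _ /(_ 1 x b); rewrite rmorph1 !mul1r. Qed.

Lemma ncs_map_iotaK F : ncs_map chi (ncs_map iota F) = F.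
Proof. by apply: funext => s; apply: bimodule_iota. Qed.

Lemma ncs_map_bimodMl F X :
  ncs_map chi (ncs_map iota F * X) = F * ncs_map chi X.
Proof.
apply: funext => s; rewrite /ncs_map !ncsM raddf_split_sum.
by apply: eq_split_sum => u v _; apply: bimoduleMl.
Qed.

Lemma ncs_map_bimodMr F X :
  ncs_map chi (X * ncs_map iota F) = ncs_map chi X * F.
Proof.
apply: funext => s; rewrite /ncs_map !ncsM raddf_split_sum.
by apply: eq_split_sum => u v _; apply: bimoduleMr.
Qed.

End Bimodule.

(** * Resolvents of an element of A and their images in B *)

Section Resolvent.
Variables (K : fieldType) (B A : algType K) (iota : {lrmorphism B -> A}).
Variables (x : A).
Local Notation z := (ncs_letter (id : B -> B)).

(** The series x (1 - z x)^-1, so that 1 + [resolvent] z is (1 - x z)^-1. *)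
Definition resolvent : ncs B A := fun s => x * \prod_(b <- s) (iota b * x).

Lemma ncs_map_letter : ncs_map iota z = ncs_letter iota.
Proof. by apply: funext => -[|b [|c s]]; rewrite /ncs_map //= rmorph0. Qed.

Lemma resolvent_fixpoint :
  resolvent = ncs_const x + ncs_const x * (ncs_map iota z * resolvent).
Proof.
apply: funext => s; rewrite -[RHS]/(_ + _) ncs_constM ncs_map_letter.
case: s => [|b s].
  by rewrite ncs_letterM_nil mulr0 addr0 /resolvent big_nil mulr1.
by rewrite ncs_letterM_cons /= add0r /resolvent big_cons !mulrA.
Qed.

Lemma resolvent_comp (al : seq B -> B) : al [::] = 0 ->
  ncs_comp resolvent al = ncs_const x +
    ncs_const x * (ncs_map iota al * ncs_comp resolvent al).
Proof.
move=> al0; rewrite {1}resolvent_fixpoint ncs_compD !ncs_compM !ncs_comp_const.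
by rewrite ncs_map_letter ncs_comp_letter // al0 rmorph0.
Qed.

Lemma resolvent_subalg (al : seq B -> B) s :
  gen_subalg iota x (ncs_comp resolvent al s).
Proof.
rewrite /ncs_comp /compose.
have sum0 : gen_subalg iota x 0 by rewrite -(rmorph0 iota); constructor.
elim/big_ind: _ => [||k _] //; first by constructor.
elim/big_ind: _ => [||q _] //; first by constructor.
rewrite /resolvent; constructor; first by constructor.
elim/big_ind: _ => [||b _]; last by do !constructor.
  by rewrite -(rmorph1 iota); constructor.
by constructor.
Qed.

Variables (chi : {linear A -> B}) (H : mseries B).
Hypothesis chiB : unital_bimodule_map iota chi.
Hypothesis boolH :
  moment_series iota chi x = ms_I B + ms_I B * H * moment_series iota chi x.

(** With m the image of the resolvent, the moment series is z + z m z; the Boolean recursion then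
    becomes the claim with a factor z on either side. *)
Lemma resolvent_boolean :
  ncs_map chi resolvent = ncs_of H + ncs_of H * (z * ncs_map chi resolvent).
Proof.
pose zA := ncs_map iota z; pose xA : ncs B A := ncs_const x.
pose M : ncs B A := fun s =>
  if s is b0 :: s' then iota b0 * \prod_(b <- s') (x * iota b) else 0.
have eM : M = zA + zA * xA * M.
  apply: funext => s; rewrite -[RHS]/(_ + _) -mulrA /zA ncs_map_letter.
  case: s => [|b0 s]; first by rewrite ncs_letterM_nil addr0.
  rewrite ncs_letterM_cons ncs_constM.
  case: s => [|b s]; first by rewrite /M big_nil /= !mulr0 mulr1 addr0.
  by rewrite /M big_cons /= add0r !mulrA.
have eM' : M = zA + zA * resolvent * zA.
  apply: ncs_fixpoint_uniq eM _; first by rewrite ncsM_nil /zA ncs_map_letter mul0r.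
  rewrite {1}resolvent_fixpoint -/xA -/zA.
  by rewrite !(mulrDl, mulrDr) !mulrA.
have eC : ncs_of (moment_series iota chi x) = z + z * ncs_map chi resolvent * z.
  transitivity (ncs_map chi M).
    by apply: funext => -[|b s]; rewrite /ncs_map //= linear0.
  rewrite eM' ncs_mapD (ncs_map_bimodMr chiB) (ncs_map_bimodMl chiB).
  by rewrite (ncs_map_iotaK chiB).
have := congr1 (@ncs_of _ _) boolH; rewrite ncs_ofD !ncs_ofM eC ncs_of_I.
set m := ncs_map chi resolvent => /addrI e.
have {}e : z * (m * z) = z * ((ncs_of H + ncs_of H * (z * m)) * z).
  by rewrite mulrA e !(mulrDl, mulrDr) !mulrA.
(* Cancels both factors z: the value of z F z on the word 1 s 1 is F s. *)
apply: funext => s; rewrite -[LHS]mulr1 -[RHS]mulr1.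
rewrite -!(ncs_Mletter_rcons id _ s 1) -[LHS]mul1r -[RHS]mul1r.
by rewrite -!(ncs_letterM_cons id _ 1) e.
Qed.

Lemma resolvent_comp_boolean (al : seq B -> B) : al [::] = 0 ->
  ncs_map chi (ncs_comp resolvent al) =
  ncs_comp (ncs_of H) al + ncs_comp (ncs_of H) al *
    ((al : ncs B B) * ncs_map chi (ncs_comp resolvent al)).
Proof.
move=> al0.
have -> : ncs_map chi (ncs_comp resolvent al) = ncs_comp (ncs_map chi resolvent) al.
  by apply: funext => s; apply: raddf_compose.
by rewrite {1}resolvent_boolean ncs_compD !ncs_compM ncs_comp_letter.
Qed.

End Resolvent.


(** * Identities in an arbitrary ring behind the factorization *)

Section RingIdentities.
Variable L : pzRingType.

Lemma linv_mulI (g x y y' : L) :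
  g * x = 1 -> x * y = x * y' -> y = y'.
Proof. by move=> gx xy; rewrite -[y]mul1r -gx -mulrA xy mulrA gx mul1r. Qed.

Lemma mulr_regroup (x y p s q w t : L) : x * y = 1 ->
  x * ((y - p * s * q * w) * t) + x * (p * (s * (q * (w * t)))) = t.
Proof. by move=> xy; rewrite -mulrDr mulrBl !mulrA subrK mulrA xy mul1r. Qed.

Lemma linv_eq_rinv (g x h : L) : g * x = 1 -> x * h = 1 -> g = h.
Proof. by move=> gx xh; rewrite -[g]mulr1 -xh mulrA gx mul1r. Qed.

Lemma expand_factor (x y q w t : L) :
  x * (1 + y * q * w) * t = x * (t + y * (q * (w * t))).
Proof. by rewrite -mulrA mulrDl mul1r !mulrA. Qed.

Section Resolvent.
Variables (x u q w : L).

Lemma fixpoint_resolvent y : q = y + x * (u * q) -> (1 - x * u) * q = y.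
Proof. by move=> e; rewrite mulrBl mul1r -mulrA {1}e addrK. Qed.

Lemma resolvent_geometric : (1 - x * u) * q = x -> (1 - x * u) * (1 + q * u) = 1.
Proof. by move=> e; rewrite mulrDr mulr1 mulrA e subrK. Qed.

Lemma recenter_left : (1 - x * u) * q = x ->
  (1 - x * u) * (q - (1 + q * u) * w) = x - w.
Proof. by move=> e; rewrite mulrBr e mulrA resolvent_geometric ?mul1r. Qed.

Lemma recenter_right : q * (1 - u * x) = x ->
  (q - w * (1 + u * q)) * (1 - u * x) = x - w.
Proof.
by move=> e; rewrite mulrBl e -mulrA [in X in w * X]mulrDl mul1r -mulrA e subrK mulr1.
Qed.

End Resolvent.

Lemma resolvent_sym (x u q g : L) : g * (1 - x * u) = 1 ->
  (1 - x * u) * q = x -> q * (1 - u * x) = x.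
Proof.
move=> gK eq; rewrite -[LHS]mul1r -[X in X * _]gK -mulrA (mulrA (1 - _)) eq.
have -> : x * (1 - u * x) = (1 - x * u) * x.
  by rewrite mulrBr mulrBl mulr1 mul1r mulrA.
by rewrite mulrA gK mul1r.
Qed.

(* [sg] is the inverse of 1 - u V. *)
Variables (a b z D V p q u al sg : L).
Hypothesis uE : u = D * z.
Hypothesis sgE : sg = 1 + u * al * V.
Hypothesis pE : (1 - a * u) * p = a - V.
Hypothesis qE : q * (1 - z * V * b) = b - D.
Hypothesis alK : al * (1 - V * u) = 1.
Hypothesis Kal : (1 - V * u) * al = 1.

(** Holds because (1 - a u)(1 + p u) = 1 - V u, whose inverse is [al]. *)
Lemma factor_left : (1 - a * u) * ((1 + p * u) * al) = 1.
Proof.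
rewrite mulrA mulrDr mulr1 mulrA pE -[RHS]Kal; congr (_ * _).
by rewrite mulrBl addrA subrK.
Qed.

(** Mirror image: (1 + V q z)(1 - V b z) = 1 - V u. *)
Lemma factor_right : al * (1 + V * q * z) * (1 - V * b * z) = 1.
Proof.
have e : z * (1 - V * b * z) = (1 - z * V * b) * z.
  by rewrite mulrBr mulrBl mulr1 mul1r !mulrA.
rewrite -mulrA mulrDl mul1r -(mulrA _ z) e (mulrA (V * q)) -(mulrA V q) qE -[RHS]alK.
congr (_ * _); rewrite mulrBr mulrBl addrA subrK.
by rewrite uE !mulrA.
Qed.

(** The outer factors turn [p] and [q] into a - V and b - D. The remaining terms collapse through sg
    u = u al and V sg = al V. *)
Lemma factor_product :
  (1 - a * u) * (al - p * sg * q * z) * (1 - V * b * z) = 1 - a * b * z.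
Proof.
have e : z * (1 - V * b * z) = (1 - z * V * b) * z.
  by rewrite mulrBr mulrBl mulr1 mul1r !mulrA.
have Val : V * u * al = al - 1.
  by apply/eqP; rewrite -Kal mulrBl mul1r opprB addrC subrK.
have alV : al * V * u = al - 1.
  by apply/eqP; rewrite -alK mulrBr mulr1 opprB addrC subrK mulrA.
have sgu : sg * u = u * al.
  by rewrite sgE mulrDl mul1r -!mulrA (mulrA al) alV mulrBr mulr1 addrC subrK.
have Vsg : V * sg = al * V.
  by rewrite sgE mulrDr mulr1 !mulrA Val mulrBl mul1r addrC subrK.
have -> : (1 - a * u) * (al - p * sg * q * z) * (1 - V * b * z) =
   (1 - a * u) * al * (1 - V * b * z) - (a - V) * (sg * (b - D) * z).
  rewrite (mulrBr _ al) [LHS]mulrBl; congr (_ - _).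
  rewrite -[LHS]mulrA -[X in _ * X]mulrA e !mulrA.
  by rewrite pE -(mulrA _ q) qE.
have -> : (a - V) * (sg * (b - D) * z) =
    a * b * z + a * u * al * V * b * z - a * u * al - al * V * b * z + (al - 1).
  have -> : sg * (b - D) * z = sg * b * z - u * al.
    by rewrite mulrBr mulrBl -(mulrA sg D) -uE sgu.
  rewrite [LHS]mulrBl !(mulrBr, mulrA) Vsg Val sgE mulrDr mulr1 !mulrDl !mulrA.
  by rewrite opprB [al - 1 - _]addrC addrA.
rewrite mulrBl mul1r mulrBl mulrBr mulrBr !mulr1 !mulrA.
apply/eqP; rewrite subr_eq !addrA subrK opprB addrA; apply/eqP.
by rewrite [RHS](ACl ((1*6)*(5*4*2*3))) /= subrr add0r.
Qed.

End RingIdentities.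

(** * Conditional freeness *)

Section ConditionalFreeness.
Variables (K : fieldType) (B A : algType K) (iota : {lrmorphism B -> A}).
Variables (phi psi : {linear A -> B}) (a b : A).
Hypotheses (phiB : unital_bimodule_map iota phi).
Hypotheses (psiB : unital_bimodule_map iota psi).
Hypothesis free_ab : cond_free iota phi psi a b.
Implicit Types (i : bool) (c y : A) (w : seq (bool * A)).

Definition centered i c : Prop :=
  gen_subalg iota (if i then a else b) c /\ psi c = 0.

Definition free_word w : Prop :=
  (forall p, p \in w -> centered p.1 p.2) /\
  sorted (fun i j => i != j) [seq p.1 | p <- w].

Definition free_word_before i w : Prop :=
  (forall p, p \in w -> centered p.1 p.2) /\
  sorted (fun i j => i != j) (rcons [seq p.1 | p <- w] i).

(** Stands for [y] being a sum of scalars and of alternating centred products that start with index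
    [i]; recording only the effect on [phi] avoids carrying the expansion. *)
Definition right_free i y : Prop := forall w, free_word_before i w ->
  phi (\prod_(p <- w) p.2 * y) = phi (\prod_(p <- w) p.2) * phi y.

Lemma phi_free_word w : free_word w ->
  phi (\prod_(p <- w) p.2) = \prod_(p <- w) phi p.2.
Proof.
case=> wc; have [->|w0] := eqVneq w [::].
  by rewrite !big_nil; case: phiB.
move=> /(sortedP true) walt.
have [|j jw|j jw|j jw|_] := free_ab (n := size w)
  (i := fun j => (nth (true, 0) w j).1) (p := fun j => (nth (true, 0) w j).2).
- by case: (w) w0.
- by have [] := wc _ (mem_nth (true, 0) jw).
- by have [] := wc _ (mem_nth (true, 0) jw).
- have := walt j; rewrite size_map => /(_ jw).
  by rewrite !(nth_map (true, 0)) // ltnW.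
- by rewrite !(big_nth (true, 0)) !big_mkord.
Qed.

Lemma free_word_before_rcons i w c : free_word_before i w -> centered i c ->
  free_word_before (~~ i) (rcons w (i, c)) /\ free_word (rcons w (i, c)).
Proof.
move=> [wc walt] cc.
have wcc p : p \in rcons w (i, c) -> centered p.1 p.2.
  by rewrite mem_rcons inE => /orP[/eqP->|/wc].
split; split=> //; rewrite map_rcons //=.
case: (w) walt => [|p w'] /=; first by case: (i).
by rewrite !rcons_path last_rcons => ->; case: (i).
Qed.

Lemma free_word_before_mulr i w c j d : free_word_before i (rcons w (j, c)) ->
  free_word_before i (rcons w (j, c * iota d)).
Proof.
move=> [wc walt]; split; last by rewrite !map_rcons in walt *.
move=> p; rewrite mem_rcons inE => /orP[/eqP->/=|pw]; last first.
  by apply: wc; rewrite mem_rcons inE pw orbT.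
have [|gc c0] := wc (j, c); first by rewrite mem_rcons mem_head.
split; first by do !constructor.
by rewrite (bimoduleMr psiB) c0 mul0r.
Qed.

Lemma right_free_iota i d : right_free i (iota d).
Proof. by move=> w _; rewrite (bimoduleMr phiB) (bimodule_iota phiB). Qed.

Lemma right_freeD i y y' : right_free i y -> right_free i y' -> right_free i (y + y').
Proof. by move=> yi yi' w wi; rewrite mulrDr !linearD mulrDr yi ?yi'. Qed.

Lemma right_free_sum i I (r : seq I) (P : pred I) (f : I -> A) :
  (forall k, P k -> right_free i (f k)) -> right_free i (\sum_(k <- r | P k) f k).
Proof.
move=> fi; apply: big_ind => //; last exact: right_freeD.
by rewrite -(rmorph0 iota); apply: right_free_iota.
Qed.

(** The scalar is absorbed into the last letter of the word, which remains centred since [psi] is a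
    bimodule map. *)
Lemma right_free_iotaM i d y : right_free i y -> right_free i (iota d * y).
Proof.
move=> yi w; rewrite (bimoduleMl phiB); case/lastP: w => [_|w [j c] wi].
  by rewrite big_nil mul1r (bimoduleMl phiB) (proj1 phiB) mul1r.
have /yi := free_word_before_mulr d wi.
rewrite -!cats1 !big_cat !big_seq1 /= !mulrA => ->.
by rewrite (bimoduleMr phiB).
Qed.

(** The word w c is alternating and may be followed by [y], so [phi] splits first before [y] and
    then over all the letters. *)
Lemma right_free_centered i c y : centered i c -> right_free (~~ i) y ->
  right_free i (c * y) /\ phi (c * y) = phi c * phi y.
Proof.
move=> cc yi.
have cy : phi (c * y) = phi c * phi y.
  have [] := @free_word_before_rcons i [::] c _ cc; first by split.
  by move=> /yi; rewrite /= big_seq1.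
split=> // w wi; rewrite cy.
have [/yi] := free_word_before_rcons wi cc.
move=> e /phi_free_word e'; have : phi (\prod_(p <- w) p.2) = \prod_(p <- w) phi p.2.
  apply: phi_free_word; case: wi => wc walt; split=> //.
  case: (w) walt => //= p w'; rewrite rcons_path; by case/andP.
move: e e'; rewrite -!cats1 !big_cat !big_seq1 /= -!mulrA => -> -> ->.
by rewrite mulrA.
Qed.

Section Series.
Implicit Types (C Y : ncs B A) (F : ncs B B) (n : nat).

Definition centered_series i C : Prop := forall s, centered i (C s).

(** Bounded in degree so that it can be proved by induction for a series given by a fixed-point
    equation. *)
Definition right_free_upto n i Y : Prop :=
  forall s, (size s < n)%N -> right_free i (Y s).

Lemma right_free_upto_iota n i F : right_free_upto n i (ncs_map iota F).
Proof. by move=> s _; apply: right_free_iota. Qed.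

Lemma right_free_uptoD n i Y Y' :
  right_free_upto n i Y -> right_free_upto n i Y' -> right_free_upto n i (Y + Y').
Proof. by move=> Yn Yn' s sn; apply: right_freeD; [apply: Yn | apply: Yn']. Qed.

Lemma right_free_upto_iotaM n i F Y :
  right_free_upto n i Y -> right_free_upto n i (ncs_map iota F * Y).
Proof.
move=> Yn s sn; apply: right_free_sum => k _; apply: right_free_iotaM; apply: Yn.
by rewrite size_drop (leq_ltn_trans (leq_subr _ _)).
Qed.

Lemma right_free_upto_letterM n i Y :
  right_free_upto n i Y -> right_free_upto n.+1 i (ncs_letter iota * Y).
Proof.
move=> Yn [|d s] sn; rewrite ?ncs_letterM_nil ?ncs_letterM_cons.
  by rewrite -(rmorph0 iota); apply: right_free_iota.
by apply: right_free_iotaM; apply: Yn.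
Qed.

Lemma right_free_upto_centeredM n i C Y : centered_series i C ->
  right_free_upto n (~~ i) Y -> right_free_upto n i (C * Y).
Proof.
move=> Cc Yn s sn; apply: right_free_sum => k _.
apply: (proj1 (right_free_centered (Cc _) _)); apply: Yn.
by rewrite size_drop (leq_ltn_trans (leq_subr _ _)).
Qed.

Lemma phi_centeredM i C Y : centered_series i C ->
  (forall n, right_free_upto n (~~ i) Y) ->
  ncs_map phi (C * Y) = ncs_map phi C * ncs_map phi Y.
Proof.
move=> Cc Yn; apply: funext => s; rewrite /ncs_map !ncsM raddf_split_sum.
apply: eq_split_sum => u v _.
by apply: (proj2 (right_free_centered (Cc _) _)); apply: (Yn (size v).+1).
Qed.

End Series.

End ConditionalFreeness.

(** * The product of two conditionally free elements *)

Section SubalgebraSeries.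
Variables (K : fieldType) (B A : algType K) (iota : {lrmorphism B -> A}) (x : A).
Implicit Types X Y : ncs B A.

Definition subalg_series X : Prop := forall s, gen_subalg iota x (X s).

Lemma subalg_series_iota (F : ncs B B) : subalg_series (ncs_map iota F).
Proof. by move=> s; constructor. Qed.

Lemma subalg_seriesD X Y :
  subalg_series X -> subalg_series Y -> subalg_series (X + Y).
Proof. by move=> Xx Yx s; constructor. Qed.

Lemma subalg_seriesB X Y :
  subalg_series X -> subalg_series Y -> subalg_series (X - Y).
Proof.
move=> Xx Yx s; constructor; first exact: Xx.
by rewrite -[(- Y) s]/(- Y s) -scaleN1r; constructor.
Qed.

Lemma subalg_seriesM X Y :
  subalg_series X -> subalg_series Y -> subalg_series (X * Y).
Proof.
move=> Xx Yx s; rewrite ncsM /split_sum; elim/big_ind: _ => [||k _].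
- by rewrite -(rmorph0 iota); constructor.
- by constructor.
- by constructor.
Qed.

End SubalgebraSeries.

Section HTransform.
Variables (K : fieldType) (B A : algType K) (iota : {lrmorphism B -> A}).
Variables (psi : {linear A -> B}) (a b : A).
Hypothesis psiB : unital_bimodule_map iota psi.
Hypothesis psia : psi a = 1.
Local Notation I := (ms_I B).
Local Notation Ha := (H_series iota psi a).
Local Notation V := (H_vdash iota psi a b).
Local Notation D := (H_dashv iota psi a b).

(** Both sides are the fixed point of X -> (T_a o E) o (D I X): V by distributing the composition in
    its definition, the other by substituting D I into the equation of H_a. *)
Lemma H_vdashE : V = Ha \oS (D * I).
Proof.
have [_ eV] := the_seriesP (H_vdashP psiB psia b).
have [_ eH] := the_seriesP (H_seriesP psiB psia).
have DI0 : (D * I) [::] = 0 by exact: ms_MInil.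
apply: (@comp_IM_uniq _ _ (T_series iota psi a \oS ms_E B) (D * I)) => //.
  rewrite {1}/H_vdash {1}eV ms_compA ms_compM ms_compI ?ms_IMnil //.
  by rewrite -mulrA.
by rewrite {1}/H_series {1}eH ms_compA ms_compM ms_compI.
Qed.

End HTransform.

Section Main.
Variables (K : fieldType) (B A : algType K) (iota : {lrmorphism B -> A}).
Variables (phi psi : {linear A -> B}) (a b : A).
Hypotheses (phiB : unital_bimodule_map iota phi).
Hypotheses (psiB : unital_bimodule_map iota psi).
Hypothesis free_ab : cond_free iota phi psi a b.
Hypotheses (phia : phi a = 1) (phib : phi b = 1).
Hypotheses (psia : psi a = 1) (psib : psi b = 1).

(** Expand (a - 1)(b - 1), an alternating centred product on which both maps vanish. This makes the
    Boolean recursion available for [a * b]. *)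
Lemma cond_free_mul1 : phi (a * b) = 1 /\ psi (a * b) = 1.
Proof.
have gen1 x : gen_subalg iota x (x - 1).
  constructor; first by constructor.
  by rewrite -(rmorph1 iota) -rmorphN; constructor.
have [||||psi0 phi0] := free_ab (n := 2) (i := fun j => j == 0)
  (p := fun j => if j == 0 then a - 1 else b - 1) => //.
- by case=> [|[|]].
- case=> [|[|]] // _; rewrite linearB ?psia ?psib (proj1 psiB); exact: subrr.
- by case.
have e (chi : {linear A -> B}) : chi 1 = 1 -> chi a = 1 -> chi b = 1 ->
    chi ((a - 1) * (b - 1)) = 0 -> chi (a * b) = 1.
  move=> chi1 chia chib.
  rewrite mulrBr mulr1 mulrBl mul1r opprB !linearD !linearN chia chib chi1.
  by rewrite subrr addr0 => /eqP; rewrite subr_eq0 => /eqP.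
split; apply: e; rewrite ?(proj1 phiB) ?(proj1 psiB) //.
  move: phi0; rewrite !big_ord_recl !big_ord0 /= !mulr1 => ->.
  by rewrite linearB phia (proj1 phiB) subrr mul0r.
by move: psi0; rewrite !big_ord_recl big_ord0 /= mulr1.
Qed.

Local Notation I := (ms_I B).
Local Notation z := (ncs_letter (id : B -> B)).
Local Notation Va := (H_vdash iota psi a b).
Local Notation Db := (H_dashv iota psi a b).
Local Notation V := (ncs_of Va).
Local Notation D := (ncs_of Db).
Local Notation lift := (ncs_map iota).
Local Notation u := (D * z).
Local Notation v := (z * V).
Local Notation Qa := (ncs_comp (resolvent iota a) u).
Local Notation Qb := (ncs_comp (resolvent iota b) v).

Let ua0 : u [::] = 0. Proof. by rewrite ncsM_nil mulr0. Qed.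
Let vb0 : v [::] = 0. Proof. by rewrite ncsM_nil mul0r. Qed.

Let lift_nil (F : ncs B B) : F [::] = 0 -> lift F [::] = 0.
Proof. by rewrite /ncs_map => ->; apply: rmorph0. Qed.

(** The series a'. Since 1 + Qa u = (1 - a u)^-1, this form shows its coefficients to lie in the
    subalgebra of [a]. *)
Definition centering_a : ncs B A := Qa - (1 + Qa * lift u) * lift V.
Definition centering_b : ncs B A := Qb - lift D * (1 + lift v * Qb).

Lemma resolvent_aP : (1 - ncs_const a * lift u) * Qa = ncs_const a.
Proof. exact/fixpoint_resolvent/resolvent_comp. Qed.

Lemma resolvent_bP : Qb * (1 - lift v * ncs_const b) = ncs_const b.
Proof.
apply: resolvent_sym (ncs_star_linv _ (lift_nil vb0)) _.
exact/fixpoint_resolvent/resolvent_comp.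
Qed.

Lemma centering_aP : (1 - ncs_const a * lift u) * centering_a = ncs_const a - lift V.
Proof. exact: recenter_left resolvent_aP. Qed.

Lemma centering_bP : centering_b * (1 - lift v * ncs_const b) = ncs_const b - lift D.
Proof. exact: recenter_right resolvent_bP. Qed.

Section Image.
Variables (chi : {linear A -> B}) (G H : mseries B).
Hypothesis chiB : unital_bimodule_map iota chi.
Hypothesis boolG : moment_series iota chi a = I + I * G * moment_series iota chi a.
Hypothesis boolH : moment_series iota chi b = I + I * H * moment_series iota chi b.
Local Notation Ga := (ncs_comp (ncs_of G) u).
Local Notation Hb := (ncs_comp (ncs_of H) v).

(** A bimodule map acts on [Qa] alone, and the Boolean recursion gives its image the equation of
    [Qa] with [Ga] for [a]. For [psi] one has Ga = V, so the image vanishes; for [phi], Ga is H^c_a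
    o u. *)
Lemma image_centering_a : (1 - Ga * u) * ncs_map chi centering_a = Ga - V.
Proof.
rewrite /centering_a ncs_mapB !(ncs_map_bimodMr chiB) ncs_mapD.
rewrite (ncs_map_bimodMr chiB) -{1}(ncs_map1 _ iota) (ncs_map_iotaK chiB).
apply: recenter_left.
exact/fixpoint_resolvent/(resolvent_comp_boolean chiB boolG ua0).
Qed.

Lemma image_centering_b : ncs_map chi centering_b * (1 - v * Hb) = Hb - D.
Proof.
rewrite /centering_b ncs_mapB !(ncs_map_bimodMl chiB) ncs_mapD.
rewrite (ncs_map_bimodMl chiB) -{1}(ncs_map1 _ iota) (ncs_map_iotaK chiB).
apply: recenter_right; apply: resolvent_sym (ncs_star_linv _ vb0) _.
exact/fixpoint_resolvent/(resolvent_comp_boolean chiB boolH vb0).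
Qed.

End Image.

Lemma centered_centering_a : centered_series iota psi a b true centering_a.
Proof.
move=> s; split.
  have Qs := resolvent_subalg iota a u.
  have Is F := @subalg_series_iota _ _ _ iota a F.
  apply: subalg_seriesB => //; do !apply: subalg_seriesM => //.
  apply: subalg_seriesD; last exact: subalg_seriesM.
  by rewrite -(ncs_map1 _ iota).
have boolHa := H_series_boolean psiB psia.
have := image_centering_a psiB boolHa.
have -> : ncs_comp (ncs_of (H_series iota psi a)) u = V.
  by rewrite [in RHS](H_vdashE b psiB psia).
rewrite subrr => e; have := ncs_star_linv V ua0.
move=> /(congr1 (fun X => X * ncs_map psi centering_a)).
by rewrite -mulrA e mulr0 mul1r => /(congr1 (fun X => X s)).
Qed.

Lemma centered_centering_b : centered_series iota psi a b false centering_b.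
Proof.
move=> s; split.
  have Qs := resolvent_subalg iota b v.
  have Is F := @subalg_series_iota _ _ _ iota b F.
  apply: subalg_seriesB => //; do !apply: subalg_seriesM => //.
  apply: subalg_seriesD; last exact: subalg_seriesM.
  by rewrite -(ncs_map1 _ iota).
have boolHb := H_series_boolean psiB psib.
have := image_centering_b psiB boolHb.
(* H_b o v is D by definition, so the right-hand side is zero. *)
rewrite -[ncs_comp _ _]/D subrr => e.
have [] := @ncs_starP _ _ (v * D) _; first by rewrite ncsM_nil vb0 mul0r.
move=> /(congr1 (fun X => ncs_map psi centering_b * X)).
by rewrite mulrA e mul0r mulr1 => /(congr1 (fun X => X s)).
Qed.

(** From here on [al] is 1 - V u itself; its inverse, called [al] in the ring identities, is
    [al1]. *)
Local Notation al := (1 - V * u).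
Local Notation al1 := (ncs_star (V * u)).
Local Notation sg := (1 + u * al1 * V).
Local Notation Qab := (resolvent iota (a * b)).
Local Notation N := (1 + Qab * lift z).

Let al_inv : al * al1 = 1 /\ al1 * al = 1.
Proof. by apply: ncs_starP; rewrite ncsM_nil ua0 mulr0. Qed.

Let liftM (F G : ncs B B) : lift (F * G) = lift F * lift G.
Proof. exact: ncs_mapM. Qed.

Let lift1 : lift 1 = 1 :> ncs B A.
Proof. exact: ncs_map1. Qed.

Let lift_al : lift al = 1 - lift V * lift u.
Proof. by rewrite ncs_mapB lift1 (liftM V u). Qed.

Let lift_sg : lift sg = 1 + lift u * lift al1 * lift V.
Proof. by rewrite ncs_mapD lift1 (liftM (u * al1) V) (liftM u al1). Qed.

(* [N] is the inverse of 1 - a b z; the factor in front of it cancels the     *)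
(* words of [N] that start in <b>.                                            *)
Definition reduced_resolvent : ncs B A := (1 - lift V * ncs_const b * lift z) * N.

Let al1K : lift al1 * (1 - lift V * lift u) = 1.
Proof. by rewrite -lift_al -liftM (proj2 al_inv) lift1. Qed.

Let alK1 : (1 - lift V * lift u) * lift al1 = 1.
Proof. by rewrite -lift_al -liftM (proj1 al_inv) lift1. Qed.

Let bhP : centering_b * (1 - lift z * lift V * ncs_const b) = ncs_const b - lift D.
Proof. by rewrite -liftM centering_bP. Qed.

Lemma N_reduced :
  N = lift al1 * (1 + lift V * centering_b * lift z) * reduced_resolvent.
Proof.
have e := factor_right (liftM D z) bhP al1K.
by rewrite /reduced_resolvent [RHS]mulrA e mul1r.
Qed.

(** Obtained from the factorization by cancelling 1 - a u and multiplying by 1 - V u. Unfolding it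
    yields alternating words that begin with a', one letter z being added at each turn. *)
Lemma reduced_resolvent_fixpoint : reduced_resolvent =
  lift al * ((1 + centering_a * lift u) * lift al1) +
  lift al * (centering_a * (lift sg * (centering_b * (lift z * reduced_resolvent)))).
Proof.
have e := factor_product (liftM D z) lift_sg centering_aP bhP al1K alK1.
have NK : (1 - ncs_const a * ncs_const b * lift z) * N = 1.
  rewrite -ncs_const_mul; apply: resolvent_geometric; apply: fixpoint_resolvent.
  exact: resolvent_fixpoint.
have eS : (1 - ncs_const a * lift u) *
    ((lift al1 - centering_a * lift sg * centering_b * lift z) * reduced_resolvent) = 1.
  by rewrite /reduced_resolvent [LHS]mulrA [LHS]mulrA e NK.
have f := factor_left centering_aP alK1.
have starK := ncs_star_linv (ncs_const a) (lift_nil ua0).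
have {eS f} : (lift al1 - centering_a * lift sg * centering_b * lift z) * reduced_resolvent =
    (1 + centering_a * lift u) * lift al1.
  by apply: (linv_mulI starK); rewrite eS f.
by move=> <-; rewrite mulr_regroup // lift_al alK1.
Qed.

(** The recursive occurrence stands behind a letter z, which gains one degree; b' and then a' switch
    the index from true to false and back. *)
Lemma reduced_resolvent_right_free n :
  right_free_upto iota phi psi a b n true reduced_resolvent.
Proof.
elim: n => // n IHn; rewrite reduced_resolvent_fixpoint.
have iotaM i m F Y := @right_free_upto_iotaM _ _ _ iota phi psi a b phiB psiB m i F Y.
have iota0 i m F := @right_free_upto_iota _ _ _ iota phi psi a b phiB m i F.
have cM := @right_free_upto_centeredM _ _ _ iota phi psi a b phiB free_ab.
apply: right_free_uptoD; apply: (iotaM).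
  rewrite mulrDl mul1r -mulrA -liftM; apply: right_free_uptoD; first exact: iota0.
  by apply: (cM) centered_centering_a _; apply: (iota0).
apply: (cM) centered_centering_a _; apply: (iotaM); apply: (cM) centered_centering_b _.
by rewrite ncs_map_letter; apply: right_free_upto_letterM.
Qed.

Local Notation p := (ncs_map phi centering_a).
Local Notation q := (ncs_map phi centering_b).
Local Notation S := (ncs_map phi reduced_resolvent).

Lemma phi_reduced :
  S = al * ((1 + p * u) * al1) + al * (p * (sg * (q * (z * S)))).
Proof.
have iotaM i m F Y := @right_free_upto_iotaM _ _ _ iota phi psi a b phiB psiB m i F Y.
have zS m : right_free_upto iota phi psi a b m true (lift z * reduced_resolvent).
  by apply: (iotaM); apply: reduced_resolvent_right_free.
have bzS m : right_free_upto iota phi psi a b m false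
    (lift sg * (centering_b * (lift z * reduced_resolvent))).
  apply: (iotaM).
  by apply: right_free_upto_centeredM centered_centering_b _.
rewrite {1}reduced_resolvent_fixpoint ncs_mapD !(ncs_map_bimodMl phiB).
rewrite (phi_centeredM phiB free_ab centered_centering_a bzS).
rewrite (ncs_map_bimodMl phiB).
rewrite (phi_centeredM phiB free_ab centered_centering_b zS).
rewrite !(ncs_map_bimodMl phiB) !(ncs_map_bimodMr phiB) ncs_mapD.
by rewrite (ncs_map_bimodMr phiB) -{1}(ncs_map1 _ iota) (ncs_map_iotaK phiB).
Qed.

Local Notation ha := (ncs_of (Hc_series iota phi psi a \oS (Db * I))).
Local Notation hb := (ncs_of (Hc_series iota phi psi b \oS (I * Va))).

(** The factorization over B, for [ha] and [hb]: its right factor 1 - V hb z cancels the prefactor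
    of S in the image of [N], and [phi_reduced] with [factor_left] cancels the rest. *)
Lemma phi_N : (1 - ha * hb * z) * ncs_map phi N = 1.
Proof.
have pE : (1 - ha * u) * p = ha - V.
  exact: image_centering_a phiB (Hc_series_boolean phiB psiB phia psia).
have qE : q * (1 - z * V * hb) = hb - D.
  exact: image_centering_b phiB (Hc_series_boolean phiB psiB phib psib).
have [alK al1al] := al_inv.
have -> : ncs_map phi N = al1 * (1 + V * q * z) * S.
  rewrite [in LHS]N_reduced !expand_factor (ncs_map_bimodMl phiB) ncs_mapD.
  rewrite (ncs_map_bimodMl phiB).
  rewrite (phi_centeredM phiB free_ab centered_centering_b); last first.
    move=> n; apply: (right_free_upto_iotaM phiB psiB).
    exact: reduced_resolvent_right_free.
  by rewrite (ncs_map_bimodMl phiB).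
rewrite -(factor_product (erefl u) (erefl sg) pE qE al1al alK) -mulrA.
have -> : (1 - V * hb * z) * (al1 * (1 + V * q * z) * S) = S.
  have [|starK _] := @ncs_starP _ _ (V * hb * z); first by rewrite ncsM_nil mulr0.
  by rewrite [LHS]mulrA (linv_eq_rinv (factor_right (erefl u) qE al1al) starK) starK mul1r.
suff e : (al1 - p * sg * q * z) * S = (1 + p * u) * al1.
  by rewrite -mulrA e (factor_left pE alK).
apply: (linv_mulI al1al); apply: (addIr (al * (p * (sg * (q * (z * S)))))).
by rewrite mulr_regroup // -phi_reduced.
Qed.

Lemma Hc_series_mul : Hc_series iota phi psi (a * b) =
  (Hc_series iota phi psi a \oS (Db * I)) * (Hc_series iota phi psi b \oS (I * Va)).
Proof.
have [phiab psiab] := cond_free_mul1.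
set H := Hc_series _ _ _ (a * b); apply: ncs_of_inj; rewrite ncs_ofM.
have mE : (1 - ncs_of H * z) * ncs_map phi Qab = ncs_of H.
  apply: fixpoint_resolvent; apply: (resolvent_boolean phiB).
  exact: Hc_series_boolean phiB psiB phiab psiab.
have NE : ncs_map phi N = 1 + ncs_map phi Qab * z.
  rewrite ncs_mapD (ncs_map_bimodMr phiB) -{1}(ncs_map1 _ iota).
  by rewrite (ncs_map_iotaK phiB).
have HN : (1 - ncs_of H * z) * ncs_map phi N = 1.
  by rewrite NE; apply: resolvent_geometric.
have starK : ncs_star (ncs_of H * z) * (1 - ncs_of H * z) = 1.
  exact: ncs_star_linv.
have {}starK : ncs_map phi N * (1 - ncs_of H * z) = 1.
  by rewrite -(linv_eq_rinv starK HN).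
(* A left inverse of the image of [N] equals its right inverse; the factor z then cancels on the
   right. *)
have e : 1 - ha * hb * z = 1 - ncs_of H * z.
  by rewrite -[LHS]mulr1 -[X in _ * X]starK [LHS]mulrA phi_N mul1r.
apply: funext => s; rewrite -[LHS]mulr1 -[RHS]mulr1.
rewrite -!(ncs_Mletter_rcons id _ s 1).
by move/addrI/oppr_inj: e => ->.
Qed.

End Main.

Theorem theorem5p2p9 (R : realType) (B A : algType R[i])
    (iota : {lrmorphism B -> A}) (phi psi : {linear A -> B}) (a b : A)
    (iota_inj : injective iota)
    (phiB : unital_bimodule_map iota phi)
    (psiB : unital_bimodule_map iota psi)
    (free_ab : cond_free iota phi psi a b)
    (phia : phi a = 1) (phib : phi b = 1)
    (psia : psi a = 1) (psib : psi b = 1) :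
  let I := ms_I B in
  let Ha := H_series iota psi a in
  let Hb := H_series iota psi b in
  let Ha_vdash_b := H_vdash iota psi a b in
  let Ha_dashv_b := H_dashv iota psi a b in
  [/\ Hc_series iota phi psi (a * b) =
        (Hc_series iota phi psi a \oS (Ha_dashv_b * I)) *
        (Hc_series iota phi psi b \oS (I * Ha_vdash_b)),
      Ha_dashv_b = Hb \oS (I * (Ha \oS (Ha_dashv_b * I))) &
      Ha_vdash_b = Ha \oS ((Hb \oS (I * Ha_vdash_b)) * I)].
Proof.
move=> I Ha Hb Hab Hba; split; last exact: H_vdashE psiB psia.
  exact: Hc_series_mul.
(* Once H_a o (D I) is folded back into V, this is the definition of [H_dashv]. *)
by rewrite /Ha /Hba -(H_vdashE b psiB psia).
Qed.
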